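(* If $\mathbf{B}$ is an $n$-string braid (regarded as an $n$-string tangle), then $\mathbf{d_U(B)}=1$. Furthermore, for a 3-string braid $\mathbf{B}=\sigma_1^{-c_1}\sigma_2^{c_2}\sigma_1^{-c_3}\cdots\sigma_2^{c_{h-1}}\sigma_1^{-c_h}$ with $h$ odd and $c_1,\dots,c_h$ integers, if the endpoint arcs are ordered as $x_1,x_2,x_3,x_4,x_5,x_6$, where $x_1,x_2,x_3$ are the left endpoint arcs in positions $1,2,3$ and $x_4,x_5,x_6$ are the right endpoint arcs in positions $1,2,3$, then $\mathbf{M_l(B)}$ is row equivalent (via integer row operations) to $$\begin{pmatrix} 1 & -1 & 1 & -1 & 1 & -1\\ 0 & 1 & 0 & E[1,c_1,\dots,c_h]-1 & -E[1,c_1,\dots,c_h,1]+1 & E[1,c_1,\dots,c_{h-1}]-1\\ 0 & 0 & 1 & E[c_2,\dots,c_h]-1 & -E[c_2,\dots,c_h,1]+1 & E[c_2,\dots,c_{h-1}]-1\end{pmatrix}.$$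
   Context: Tangles. An $n$-string tangle is a 3-ball with $n$ strings (arcs) properly embedded in it, considered up to isotopy fixing the boundary. An arc of a tangle diagram is a maximal connected piece running between undercrossings and/or endpoints; an endpoint arc has an endpoint on the boundary, the other arcs are interior arcs. Fix an ordering of the $2n$ endpoints. Coloring matrix: assign a variable to each arc. If a string projects to a single arc, that arc is given two variables $x_i,x_j$, one for each of its endpoints, and the equation $x_i-x_j=0$ is added. Each crossing with overarc $x$ and underarcs $y,z$ gives the equation $y+z-2x=0$. The integer coefficient matrix $\mathbf{M_T}$ of these equations has the interior-arc columns first and the $2n$ endpoint-arc columns last in the fixed order; with $k$ equations it is a $k\times(k+n)$ matrix. Allowed row operations: exchanging two rows, adding an integer multiple of one row to a different row, multiplying a row by $-1$. Row equivalent means related by these operations. The standard echelon form $SF(\mathbf{M_T})$ is the unique matrix row equivalent to $\mathbf{M_T}$ that is in echelon form, has positive leading entries, and in which every entry above a leading entry is nonnegative and strictly less than that leading entry. $\mathbf{d_U(T)}$ is the absolute value of the determinant of the upper left $(k-n)\times(k-n)$ submatrix of $SF(\mathbf{M_T})$ (equal to $1$ if $k=n$), and $\mathbf{M_l(T)}$ is the lower right $n\times 2n$ submatrix of $SF(\mathbf{M_T})$; both are tangle invariants (given the ordering of endpoints). Braids. An $n$-string braid is a union $\mathbf{B}=b_1\cup\dots\cup b_n$ of $n$ strings in $D^2\times[0,1]$ such that for each $t\in[0,1]$, $\mathbf{B}$ meets $D^2\times\{t\}$ transversely in $n$ distinct interior points, with the $2n$ endpoints fixed. Braid diagrams are drawn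 horizontally, with $n$ positions numbered $1,\dots,n$ across the braid at each vertical slice, and a braid word is read from left to right, its first letter being leftmost. Convention for the generators: $\sigma_i$ is a single crossing between positions $i$ and $i+1$ in which the strand going, from left to right, from position $i+1$ to position $i$ is the overstrand; in $\sigma_i^{-1}$ the strand going from position $i$ to position $i+1$ is the overstrand. Euler bracket: $E[c_1,\dots,c_h]$ is the sum of all products obtained from $c_1c_2\cdots c_h$ by omitting zero or more disjoint pairs of consecutive $c_i$'s; e.g. $E[c_1]=c_1$, $E[c_1,c_2]=c_1c_2+1$, $E[c_1,c_2,c_3]=c_1c_2c_3+c_1+c_3$, and $E[\,]=1$. It satisfies $E[c_1,\dots,c_h]=c_1E[c_2,\dots,c_h]+E[c_3,\dots,c_h]$. In the case $h=1$: $E[c_2,\dots,c_h]=E[\,]=1$, $E[c_2,\dots,c_h,1]=E[1]=1$, $E[1,c_1,\dots,c_{h-1}]=E[1]=1$, and by convention $E[c_2,\dots,c_{h-1}]=0$. *)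

(* Defs.v *)
(* MathComp / MathComp-Analysis. *)
From HB Require Import structures.
From mathcomp Require Import all_boot all_order all_algebra finmap.
From mathcomp Require Import all_classical all_reals all_analysis.

Set Implicit Arguments.
Unset Strict Implicit.
Unset Printing Implicit Defensive.

Import Order.TTheory GRing.Theory Num.Theory.
Import numFieldNormedType.Exports.

Local Open Scope classical_set_scope.
Local Open Scope ring_scope.

(* The 3-ball is modelled as D^2 x [0,1].  A string is a parametrized arc with
   three coordinates: [lev] is the coordinate in [0,1] (horizontal in the
   diagram, left to right), [pos] the other coordinate of the plane of the
   diagram, and [hgt] the height towards the viewer; (pos, hgt) lies in the
   unit disc D^2.  Only parameters in [0,1] are meaningful. *)
Record tangle (R : realType) (n : nat) := Tangle {
  lev : 'I_n -> R -> R;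
  pos : 'I_n -> R -> R;
  hgt : 'I_n -> R -> R;
  lev_cont : forall i, {within `[0, 1], continuous (lev i)};
  pos_cont : forall i, {within `[0, 1], continuous (pos i)};
  hgt_cont : forall i, {within `[0, 1], continuous (hgt i)};
  strings_embedded : forall i j s t, 0 <= s <= 1 -> 0 <= t <= 1 ->
    lev i s = lev j t -> pos i s = pos j t -> hgt i s = hgt j t ->
    i = j /\ s = t;
  strings_inside : forall i s, 0 < s < 1 ->
    0 < lev i s < 1 /\ pos i s ^+ 2 + hgt i s ^+ 2 < 1;
  ends_on_boundary : forall i s, s = 0 \/ s = 1 ->
    [/\ 0 <= lev i s <= 1, pos i s ^+ 2 + hgt i s ^+ 2 <= 1
      & [\/ lev i s = 0, lev i s = 1 | pos i s ^+ 2 + hgt i s ^+ 2 = 1]]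
}.

(* n strings meeting each of the discs D^2 x {t} transversely in n points are
   graphs over the level t, so each string is parametrized by its level. The n
   points of a level are distinct by [strings_embedded]. *)
Definition is_braid (R : realType) (n : nat) (B : tangle R n) : Prop :=
  forall i t, 0 <= t <= 1 ->
    lev B i t = t /\ pos B i t ^+ 2 + hgt B i t ^+ 2 < 1.

Section Diagram.
Variables (R : realType) (n : nat) (T : tangle R n).

(* A point of the tangle: a string and a parameter on it. *)
Definition tpoint : Type := ('I_n * R)%type.

Definition double_point (p q : tpoint) : Prop :=
  [/\ p <> q, 0 <= p.2 <= 1, 0 <= q.2 <= 1,
      lev T p.1 p.2 = lev T q.1 q.2 & pos T p.1 p.2 = pos T q.1 q.2].

(* The projection to the (lev, pos)-plane is a tangle diagram: finitely many
   double points, no triple point, no double point at an endpoint, and the two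
   strands cross transversely at each double point. *)
Definition regular : Prop :=
  [/\ finite_set [set pq : tpoint * tpoint | double_point pq.1 pq.2],
      forall p q r, double_point p q -> double_point p r -> q = r,
      forall p q, double_point p q -> 0 < p.2 < 1,
      forall p q, double_point p q ->
        derivable (lev T p.1) p.2 1 /\ derivable (pos T p.1) p.2 1
    & forall p q, double_point p q ->
        derive1 (lev T p.1) p.2 * derive1 (pos T q.1) q.2
        != derive1 (pos T p.1) p.2 * derive1 (lev T q.1) q.2 ].

(* At the crossing of p and q, the strand through q is the overstrand. *)
Definition crossing (p q : tpoint) : Prop :=
  double_point p q /\ hgt T p.1 p.2 < hgt T q.1 q.2.

Definition under (i : 'I_n) (s : R) : Prop := exists q, crossing (i, s) q.

Definition nunder (i : 'I_n) : nat := #|` fset_set [set u | under i u]|%fset.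

(* The arcs of string i are its nunder i + 1 pieces between undercrossings,
   numbered from 0 along the string; arc_index i s is the number of the arc
   containing the point s (of the arc ending at s if s is an undercrossing). *)
Definition arc_index (i : 'I_n) (s : R) : nat :=
  #|` fset_set [set u | under i u /\ u < s]|%fset.

(* The variable (i, a) stands for the a-th arc of string i; a string projecting
   to a single arc has the two variables (i, 0) and (i, 1). *)
Definition tvar : Type := ('I_n * nat)%type.

Definition last_arc (i : 'I_n) : nat := maxn 1 (nunder i).

Definition is_var (v : tvar) : Prop := (v.2 <= last_arc v.1)%N.

(* v is a variable of the arc of string i containing the point s; either of the
   two variables of a string projecting to a single arc is allowed. *)
Definition var_at (i : 'I_n) (s : R) (v : tvar) : Prop :=
  v.1 = i /\ (if nunder i == 0%N then (v.2 <= 1)%N else v.2 == arc_index i s).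

(* An endpoint: a string i, and false for its start s = 0, true for its end
   s = 1. *)
Definition endpoint : Type := ('I_n * bool)%type.

Definition endpoint_var (e : endpoint) : tvar :=
  (e.1, if e.2 then last_arc e.1 else 0%N).

Inductive equation :=
  | CrossingEq of 'I_n & R   (* indexed by the point on the understrand *)
  | SingleArcEq of 'I_n.

Definition is_equation (e : equation) : Prop :=
  match e with
  | CrossingEq i u => under i u
  | SingleArcEq i => nunder i = 0%N
  end.

(* coef v is the coefficient of the variable v in the equation e; coefficients
   are added up when some of the arcs at a crossing coincide. *)
Definition has_coefs (e : equation) (coef : tvar -> int) : Prop :=
  match e with
  | CrossingEq i u =>
      exists q x, [/\ crossing (i, u) q, var_at q.1 q.2 x
        & forall v, coef v = (v == (i, arc_index i u))%:R
                           + (v == (i, (arc_index i u).+1))%:R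
                           - 2 * (v == x)%:R]
  | SingleArcEq i =>
      forall v, coef v = (v == (i, 0%N))%:R - (v == (i, 1%N))%:R
  end.

(* There are k = m + n equations and m interior arcs. The equations and the
   interior arcs are listed in any order, the endpoint arcs in the order eo. *)
Definition is_coloring_matrix (eo : 'I_(n + n) -> endpoint) (m : nat)
    (M : 'M[int]_(m + n, m + (n + n))) : Prop :=
  exists (var : 'I_(m + (n + n)) -> tvar) (eqn : 'I_(m + n) -> equation),
    [/\ injective var /\ range var = [set v | is_var v],
        forall e, var (rshift m e) = endpoint_var (eo e),
        injective eqn /\ range eqn = [set e | is_equation e]
      & forall r, exists coef : tvar -> int,
          has_coefs (eqn r) coef /\ forall c, M r c = coef (var c)].

(* For braids, where the parameter of a point is its level: position, from 1 to
   n, of string i in the vertical slice at level t. *)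
Definition position (i : 'I_n) (t : R) : nat :=
  #|[pred j : 'I_n | pos T j t < pos T i t]|.+1.

(* The letter (g, true) stands for sigma_g and (g, false) for sigma_g^-1. *)
Definition letter : Type := (nat * bool)%type.

Definition letter_at (t : R) (l : letter) : Prop :=
  let: (g, e) := l in
  let start := if e then g.+1 else g in
  let stop := if e then g else g.+1 in
  exists over und : 'I_n,
    [/\ crossing (und, t) (over, t),
        \forall s \near t^'-, position over s = start /\ position und s = stop
      & \forall s \near t^'+, position over s = stop /\ position und s = start].

Definition reads_word (w : seq letter) : Prop :=
  exists ts : seq R,
    [/\ sorted <%R ts /\ size ts = size w,
        forall t, t \in ts <-> exists i, under i t,
        forall i j t, under i t -> under j t -> i = j
      & forall k, (k < size w)%N -> letter_at (nth 0 ts k) (nth (0%N, true) w k)].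

(* Left endpoints in positions 1, ..., n, then right endpoints in positions
   1, ..., n. *)
Definition left_right_order (eo : 'I_(n + n) -> endpoint) : Prop :=
  forall p : 'I_n,
    [/\ (eo (lshift n p)).2 = false, position (eo (lshift n p)).1 0 = p.+1,
        (eo (rshift n p)).2 = true & position (eo (rshift n p)).1 1 = p.+1].

End Diagram.

Inductive row_equiv (p q : nat) (A : 'M[int]_(p, q)) : 'M[int]_(p, q) -> Prop :=
  | row_equiv_refl : row_equiv A A
  | row_equiv_swap B i j : row_equiv A B -> row_equiv A (xrow i j B)
  | row_equiv_add B (i j : 'I_p) (a : int) : i != j -> row_equiv A B ->
      row_equiv A (\matrix_(r, c) (B r c + (if r == i then a * B j c else 0)))
  | row_equiv_opp B (i : 'I_p) : row_equiv A B ->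
      row_equiv A (\matrix_(r, c) (if r == i then - B r c else B r c)).

Definition leading (p q : nat) (S : 'M[int]_(p, q)) (r : 'I_p) (c : 'I_q) : Prop :=
  S r c != 0 /\ forall c' : 'I_q, (c' < c)%N -> S r c' = 0.

Definition echelon (p q : nat) (S : 'M[int]_(p, q)) : Prop :=
  forall (r r' : 'I_p) (c' : 'I_q), (r < r')%N -> leading S r' c' ->
    exists2 c : 'I_q, (c < c')%N & leading S r c.

Definition is_SF (p q : nat) (M S : 'M[int]_(p, q)) : Prop :=
  [/\ row_equiv M S, echelon S,
      forall r c, leading S r c -> 0 < S r c
    & forall (r r' : 'I_p) c, leading S r c -> (r' < r)%N -> 0 <= S r' c < S r c].

(* The default value 0 is never used, as every integer matrix has a (unique)
   standard echelon form. *)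
Definition SF (p q : nat) (M : 'M[int]_(p, q)) : 'M[int]_(p, q) :=
  xget 0 [set S | is_SF M S].

(* For a coloring matrix with k = m + n rows; a 0 x 0 determinant is 1. *)
Definition dU (n m : nat) (M : 'M[int]_(m + n, m + (n + n))) : int :=
  `| \det (ulsubmx (SF M)) |.

Definition Ml (n m : nat) (M : 'M[int]_(m + n, m + (n + n))) : 'M[int]_(n, n + n) :=
  drsubmx (SF M).

(* A set of disjoint pairs of consecutive entries of a sequence of length h is
   given by the set P of the (0-based) indices of their first elements. *)
Definition disjoint_pairs (h : nat) (P : {set 'I_h}) : bool :=
  [forall p in P, (p.+1 < h)%N && [forall q in P, q != p.+1 :> nat]].

Definition omitted (h : nat) (P : {set 'I_h}) (j : 'I_h) : bool :=
  [exists p in P, (j == p) || (j == p.+1 :> nat)].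

Definition euler (c : seq int) : int :=
  \sum_(P : {set 'I_(size c)} | disjoint_pairs P)
    \prod_(j < size c | ~~ omitted P j) c`_j.

(* E[c_2, ..., c_(h-1)] for c = (c_1, ..., c_h); it is 0 for h = 1 by
   convention. *)
Definition euler_inner (c : seq int) : int :=
  if size c == 1%N then 0 else euler (behead (take (size c).-1 c)).

Definition gen_pow (g : nat) (a : int) : seq letter := nseq `|a|%N (g, 0 < a).

(* sigma_1^(-c_1) sigma_2^(c_2) sigma_1^(-c_3) ..., where c_1 = c`_0. *)
Definition three_braid_word (c : seq int) : seq letter :=
  flatten [seq if odd k then gen_pow 2 c`_k else gen_pow 1 (- c`_k)
          | k <- iota 0 (size c)].

Definition three_braid_matrix (c : seq int) : 'M[int]_(3, 3 + 3) :=
  let h := size c in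
  let rows : seq (seq int) :=
    [:: [:: 1; -1; 1; -1; 1; -1];
        [:: 0; 1; 0; euler (1 :: c) - 1; - euler (1 :: rcons c 1) + 1;
            euler (1 :: take h.-1 c) - 1];
        [:: 0; 0; 1; euler (behead c) - 1; - euler (rcons (behead c) 1) + 1;
            euler_inner c - 1]] in
  \matrix_(r, s) (nth [::] rows r)`_s.

(* Main.v *)
Require Import Defs.
From mathcomp Require Import all_boot all_order all_algebra finmap.
From mathcomp Require Import all_classical all_reals all_analysis.
From mathcomp Require Import perm zify ring lra.

Set Implicit Arguments.
Unset Strict Implicit.
Unset Printing Implicit Defensive.

Import Order.TTheory GRing.Theory Num.Theory.
Import numFieldNormedType.Exports.

Local Open Scope ring_scope.

(** A colouring of a braid is determined, from left to right, by the colours at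
    its left end.

    Consider the free abelian group on the variables modulo the rows of the
    coloring matrix [M].  At an undercrossing the outgoing understrand has colour
    [2 x - y], where [x] is the colour of the overstrand and [y] that of the
    incoming understrand, and in a braid both arcs start further to the left.
    So every variable is, modulo the rows of [M], an integer combination of
    endpoint variables ([colour_generated]): the interior columns of [M] have a
    left inverse ([interior_generated]).  Since an echelon matrix is upper
    triangular, the lower left block of the standard echelon form [SF M] vanishes
    and its upper left block is then unimodular, which gives [dU M = 1]
    ([dU_eq1]).

    It follows that a relation between endpoint variables alone is a combination
    of the rows of [Ml M].  The rows of [three_braid_matrix c] are such
    relations, and its left half is unitriangular, so the matrix expressing its
    rows through those of [Ml M] is unimodular, that is, a product of elementary
    operations ([Ml_row_equiv], [unitmx_row_equiv]).

    To see that these rows are relations, the slice at level [t] is coloured by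
    position and [t] moves from 0 to 1: between two crossings the intermediate
    value theorem keeps the order of the strings, and a crossing acts by
    [letter_act] ([coloured_letter], [coloured_word]).  On colours
    [(x1, x2, x3)] the braid preserves [x1 - x2 + x3], while a syllable adds a
    multiple of one of the differences [x2 - x1], [x3 - x2] to the other; Euler
    brackets are the continuants that express the initial differences through the
    final ones ([alternating_word_diff], [three_braid_matrix_relations]). *)

(** * Integer row operations *)

Lemma delta_mulmxE p q r (i : 'I_p) (j : 'I_q) (B : 'M[int]_(q, r)) k c :
  (delta_mx i j *m B) k c = if k == i then B j c else 0.
Proof.
rewrite mxE (bigD1 j) //= big1 => [|l lj]; first rewrite mxE eqxx andbT addr0.
  by case: eqP => _; rewrite ?mul1r ?mul0r.
by rewrite mxE (negPf lj) andbF mul0r.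
Qed.

Section RowEquivalence.
Variables p q : nat.
Implicit Types A B C : 'M[int]_(p, q).

Lemma row_equiv_trans A B C : row_equiv A B -> row_equiv B C -> row_equiv A C.
Proof.
move=> AB; elim=> [//|D i j _ IH|D i j a ij _ IH|D i _ IH].
- exact: row_equiv_swap.
- exact: row_equiv_add.
- exact: row_equiv_opp.
Qed.

Lemma add_row_mulmx i j (a : int) B :
  \matrix_(r, c) (B r c + (if r == i then a * B j c else 0))
  = (1%:M + a *: delta_mx i j) *m B.
Proof.
rewrite mulmxDl mul1mx -scalemxAl; apply/matrixP => r c.
rewrite [LHS]mxE [RHS]mxE; congr (_ + _).
by rewrite [RHS]mxE delta_mulmxE; case: eqP => _; rewrite ?mulr0.
Qed.

Lemma opp_row_mulmx i B :
  \matrix_(r, c) (if r == i then - B r c else B r c)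
  = (1%:M + (- 2) *: delta_mx i i) *m B.
Proof.
rewrite mulmxDl mul1mx -scalemxAl; apply/matrixP => r c.
rewrite [LHS]mxE [RHS]mxE [X in _ = _ + X]mxE delta_mulmxE.
case: eqP => [->|_]; last by rewrite mulr0 addr0.
by ring.
Qed.

End RowEquivalence.

Lemma unit_add_delta p (i j : 'I_p) (a : int) : i != j ->
  1%:M + a *: delta_mx i j \in unitmx.
Proof.
move=> ij; apply: (mulmx1_unit (B := 1%:M + (- a) *: delta_mx i j) _).1.
rewrite mulmxDl mul1mx mulmxDr mulmx1 -scalemxAl -scalemxAr.
rewrite mul_delta_mx_0 1?eq_sym // !scaler0 addr0 -addrA -scalerDl addNr.
by rewrite scale0r addr0.
Qed.

Lemma unit_opp_delta p (i : 'I_p) : 1%:M + (- 2 : int) *: delta_mx i i \in unitmx.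
Proof.
apply: (mulmx1_unit (B := 1%:M + (- 2) *: delta_mx i i) _).1.
rewrite mulmxDl mul1mx mulmxDr mulmx1 -scalemxAl -scalemxAr.
rewrite mul_delta_mx -addrA scalerA -!scalerDl.
by rewrite scale0r addr0.
Qed.

Lemma row_equiv_mulmxr p q r (D : 'M[int]_(q, r)) (A B : 'M[int]_(p, q)) :
  row_equiv A B -> row_equiv (A *m D) (B *m D).
Proof.
elim=> [|E i j _ IH|E i j a ij _ IH|E i _ IH]; first exact: row_equiv_refl.
- by rewrite xrowE -mulmxA -xrowE; apply: row_equiv_swap.
- by rewrite add_row_mulmx -mulmxA -add_row_mulmx; apply: row_equiv_add.
- by rewrite opp_row_mulmx -mulmxA -opp_row_mulmx; apply: row_equiv_opp.
Qed.

Lemma row_equiv_unitmx p q (A B : 'M[int]_(p, q)) :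
  row_equiv A B -> exists2 U : 'M[int]_p, U \in unitmx & B = U *m A.
Proof.
elim=> [|E i j _ [U uU ->]|E i j a ij _ [U uU ->]|E i _ [U uU ->]].
- by exists 1%:M; rewrite ?unitmx1 ?mul1mx.
- by exists (tperm_mx i j *m U); rewrite ?xrowE ?mulmxA // unitmx_mul uU andbT unitmx_perm.
- exists ((1%:M + a *: delta_mx i j) *m U); rewrite ?add_row_mulmx ?mulmxA //.
  by rewrite unitmx_mul uU andbT unit_add_delta.
- exists ((1%:M + (- 2) *: delta_mx i i) *m U); rewrite ?opp_row_mulmx ?mulmxA //.
  by rewrite unitmx_mul uU andbT unit_opp_delta.
Qed.

(** * The standard echelon form *)

Section HermiteForm.
Variables p q : nat.
Implicit Types A B C : 'M[int]_(p, q).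

(** Euclid's algorithm on the entries of column [k] in the rows from [r] on; it
    leaves a nonnegative entry in row [r] and zeros below. *)
Lemma column_clear A (r : nat) (k : 'I_q) :
  (forall (i : 'I_p) (c : 'I_q), (r <= i)%N -> (c < k)%N -> A i c = 0) ->
  exists B, [/\ row_equiv A B,
    forall (i : 'I_p) (c : 'I_q), (r <= i)%N -> (c < k)%N -> B i c = 0,
    forall i : 'I_p, (i < r)%N -> B i =1 A i,
    forall i : 'I_p, (r < i)%N -> B i k = 0
  & forall i : 'I_p, i = r :> nat -> 0 <= B i k].
Proof.
move: {2}(\sum_(i < p | (r <= i)%N) `|A i k|%N)
  (leqnn (\sum_(i < p | (r <= i)%N) `|A i k|%N)) => N.
elim: N A => [|N IH] A leN A0.
  have Ak (i : 'I_p) : (r <= i)%N -> A i k = 0.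
    move=> ri; move: leN; rewrite (bigD1 i) //= leqn0 addn_eq0.
    by case/andP; rewrite absz_eq0 => /eqP.
  exists A; split=> // [|i /ltnW /Ak //|i ir]; first exact: row_equiv_refl.
  by rewrite Ak // ir.
case: (boolP [exists ij : 'I_p * 'I_p, [&& (r <= ij.1)%N, (r <= ij.2)%N,
   ij.1 != ij.2, A ij.2 k != 0 & (`|A ij.2 k| <= `|A ij.1 k|)%N]]).
  (* Adding or subtracting the smaller entry decreases the sum of absolute
     values. *)
  case/existsP=> -[i j] /= /and5P[ri rj ij Aj Aji].
  pose a : int := if (0 <= A i k) == (0 <= A j k) then -1 else 1.
  have lta : (`|(A i k + a * A j k)%R| < `|A i k|)%N.
    by rewrite /a; case: ifP; lia.
  pose B := \matrix_(x, c) (A x c + (if x == i then a * A j c else 0)).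
  have AB : row_equiv A B by apply: row_equiv_add => //; apply: row_equiv_refl.
  have [||C [BC C0 Cr Ck Cp]] := IH B.
  - rewrite -ltnS; apply: leq_trans leN; rewrite (bigD1 i) //=.
    rewrite [X in (_ < X)%N](bigD1 i) //= mxE eqxx.
    rewrite (eq_bigr (fun x => `|A x k|%N)) ?ltn_add2r //.
    by move=> x /andP[_ /negPf xi]; rewrite mxE xi addr0.
  - move=> x c rx ck; rewrite mxE !A0 // mulr0; case: ifP => _; exact: addr0.
  exists C; split=> //; first exact: row_equiv_trans AB BC.
  move=> x xr c; rewrite Cr // mxE; case: eqP => [xi|_]; last by rewrite addr0.
  by move: xr; rewrite xi ltnNge ri.
move/existsPn => noij.
(* At most one entry is nonzero: it is moved to row r and made positive. *)
have uniq_nz (i j : 'I_p) : (r <= i)%N -> (r <= j)%N -> A i k != 0 -> A j k != 0 -> i = j.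
  move=> ri rj Ai Aj; apply/eqP; apply: contraT => ij.
  have := noij (i, j); have := noij (j, i); rewrite /= ri rj ij eq_sym ij Ai Aj /=.
  by lia.
case: (ltnP r p) => [ltrp|lepr]; last first.
  exists A; split=> //; first exact: row_equiv_refl.
  - by move=> i /ltn_trans/(_ (ltn_ord i)); rewrite ltnNge lepr.
  - by move=> i ir; have := ltn_ord i; rewrite ir ltnNge lepr.
pose r0 := Ordinal ltrp.
have [j [rj jP]] : exists j : 'I_p, (r <= j)%N /\
    forall i : 'I_p, (r <= i)%N -> i != j -> A i k = 0.
  case: (boolP [exists j : 'I_p, (r <= j)%N && (A j k != 0)]).
    case/existsP=> j /andP[rj Aj]; exists j; split=> // i ri ij.
    by apply/eqP; apply: contraNT ij => Ai; apply/eqP; apply: uniq_nz.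
  move/existsPn=> nz; exists r0; split=> // i ri _; apply/eqP.
  by have := nz i; rewrite ri /= negbK.
pose B := xrow r0 j A.
have AB : row_equiv A B by apply: row_equiv_swap; apply: row_equiv_refl.
have BE i c : B i c = A (tperm r0 j i) c by rewrite !mxE.
have Br (i : 'I_p) : (r <= i)%N -> (r <= tperm r0 j i)%N.
  by move=> ri; case: tpermP => // _; rewrite /r0.
have B0 (i : 'I_p) (c : 'I_q) : (r <= i)%N -> (c < k)%N -> B i c = 0.
  by move=> ri ck; rewrite BE A0 // Br.
have Blt (i : 'I_p) : (i < r)%N -> B i =1 A i.
  move=> ir c; rewrite BE tpermD //; apply: contraTneq ir => <-.
    by rewrite ltnn.
  by rewrite -leqNgt.
have Bk (i : 'I_p) : (r < i)%N -> B i k = 0.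
  move=> ri; rewrite BE jP ?Br 1?ltnW //.
  rewrite -{2}(tpermL r0 j) (inj_eq perm_inj).
  by apply: contraTneq ri => ->; rewrite ltnn.
case: (lerP 0 (B r0 k)) => Brk.
  by exists B; split=> // i ir; rewrite (_ : i = r0) //; apply: val_inj.
exists (\matrix_(x, c) (if x == r0 then - B x c else B x c)); split.
- exact: row_equiv_opp.
- by move=> i c ri ck; rewrite mxE B0 // oppr0 if_same.
- move=> i ir c; rewrite mxE -Blt //; case: eqP => // e.
  by move: ir; rewrite e ltnn.
- by move=> i ri; rewrite mxE Bk // oppr0 if_same.
- move=> i ir; rewrite mxE (_ : i = r0) ?eqxx; last exact: val_inj.
  by rewrite oppr_ge0 ltW.
Qed.

Lemma row_equiv_addrows A (r : 'I_p) (a : 'I_p -> int) : a r = 0 ->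
  row_equiv A (\matrix_(i, c) (A i c + a i * A r c)).
Proof.
move=> ar.
suff H (s : seq 'I_p) : uniq s ->
    row_equiv A (\matrix_(i, c) (A i c + (if i \in s then a i else 0) * A r c)).
  have := H _ (enum_uniq 'I_p); congr row_equiv; apply/matrixP=> i c.
  by rewrite !mxE mem_enum.
elim: s => [_|x s IH /= /andP[xs us]].
  rewrite [X in row_equiv _ X](_ : _ = A); first exact: row_equiv_refl.
  by apply/matrixP=> i c; rewrite !mxE mul0r addr0.
have [xr|xr] := eqVneq x r.
  move: (IH us); congr row_equiv; apply/matrixP=> i c; rewrite !mxE inE xr.
  by case: eqP => [->|//] /=; rewrite ar if_same.
have := row_equiv_add (a x) xr (IH us); congr row_equiv.
apply/matrixP=> i c; rewrite !mxE inE ar if_same mul0r addr0.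
by case: (eqVneq i x) => [->|] /=; rewrite ?(negPf xs) ?mul0r addr0.
Qed.

(** The first [r] rows are in standard echelon form with their leading entries in
    the first [k] columns, and the other rows vanish there. *)
Definition partial_SF (k r : nat) (A : 'M[int]_(p, q)) :=
  [/\ forall (i : 'I_p) (c : 'I_q), (r <= i)%N -> (c < k)%N -> A i c = 0,
      forall i : 'I_p, (i < r)%N -> exists2 c : 'I_q, (c < k)%N & leading A i c,
      forall (i i' : 'I_p) (c c' : 'I_q), (i < i')%N -> (i' < r)%N ->
        leading A i c -> leading A i' c' -> (c < c')%N
    & forall (i : 'I_p) (c : 'I_q), (i < r)%N -> leading A i c ->
        0 < A i c /\ forall i' : 'I_p, (i' < i)%N -> 0 <= A i' c < A i c].

Lemma leading_inj A i c c' : leading A i c -> leading A i c' -> c = c'.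
Proof.
move=> [n0 z0] [n1 z1]; apply: val_inj => /=; case: (ltngtP c c') => // h.
- by rewrite z1 ?eqxx in n0.
- by rewrite z0 ?eqxx in n1.
Qed.

Lemma partial_SF_exists A (k : nat) : (k <= q)%N ->
  exists B r, [/\ row_equiv A B, partial_SF k r B & (r <= p)%N].
Proof.
elim: k => [_|k IH ltkq].
  by exists A, 0%N; split=> //; apply: row_equiv_refl.
have [B [r [AB [B0 Bl Be Bp] lerp]]] := IH (ltnW ltkq).
pose k0 := Ordinal ltkq.
have [C [BC C0 Cr Ck Cp]] := @column_clear B r k0 B0.
have AC := row_equiv_trans AB BC.
have lC (i : 'I_p) c : (i < r)%N -> leading C i c <-> leading B i c.
  move=> ir; rewrite /leading Cr //; split=> -[? h]; split=> // c' ?.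
    by rewrite -Cr // h.
  by rewrite Cr // h.
have CSF : partial_SF k r C.
  split=> [//|i ir|i i' c c' ii' i'r|i c ir].
  - by have [c ck /lC lc] := Bl i ir; exists c => //; apply: lc.
  - rewrite !lC //; [exact: Be | exact: ltn_trans ii' i'r].
  - rewrite lC // => /(Bp _ _ ir); rewrite Cr // => -[? h]; split=> // i' i'i.
    by rewrite Cr ?h // (ltn_trans i'i).
case: (boolP [exists r0 : 'I_p, (r0 == r :> nat) && (C r0 k0 != 0)]); last first.
  (* Column k has no pivot. *)
  move/existsPn=> nr0; exists C, r; split=> //.
  have [_ Cl Ce CP] := CSF; split=> // [i c ri|i ir]; last first.
    by have [c ck ?] := Cl i ir; exists c => //; rewrite ltnS ltnW.
  rewrite ltnS leq_eqVlt => /orP[/eqP ck|]; last exact: C0.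
  rewrite (_ : c = k0); last exact: val_inj.
  move: ri; rewrite leq_eqVlt => /orP[/eqP ri|]; last exact: Ck.
  by have := nr0 i; rewrite -ri eqxx /= negbK => /eqP.
case/existsP=> r0 /andP[/eqP r0r nz].
have pos : 0 < C r0 k0 by rewrite lt_neqAle eq_sym nz Cp.
(* The entries above the pivot are replaced by their remainders. *)
pose a (i : 'I_p) : int := if (i < r)%N then - (C i k0 %/ C r0 k0)%Z else 0.
pose D := \matrix_(i, c) (C i c + a i * C r0 c).
have AD : row_equiv A D.
  apply: row_equiv_trans AC _; apply: row_equiv_addrows.
  by rewrite /a r0r ltnn.
have Dge (i : 'I_p) c : (r <= i)%N -> D i c = C i c.
  by move=> ri; rewrite mxE /a ltnNge ri /= mul0r addr0.
have Dlt i (c : 'I_q) : (c < k)%N -> D i c = C i c.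
  by move=> ck; rewrite mxE (C0 r0) ?r0r // mulr0 addr0.
have lr0 : leading D r0 k0.
  have rr0 : (r <= r0)%N by rewrite r0r.
  by split=> [|c ck]; rewrite Dge //; apply: C0.
have [_ Cl Ce CP] := CSF.
have lD (i : 'I_p) (c : 'I_q) : (c < k)%N -> leading C i c <-> leading D i c.
  move=> ck; rewrite /leading Dlt //; split=> -[? h]; split=> // c' c'c.
    by rewrite Dlt ?h // (ltn_trans c'c).
  by rewrite -Dlt ?h // (ltn_trans c'c).
have lD' (i : 'I_p) (c : 'I_q) : (i < r)%N -> leading D i c -> (c < k)%N.
  move=> ir lc; have [c' c'k lc'] := Cl i ir.
  by rewrite (leading_inj lc ((lD _ _ c'k).1 lc')).
exists D, r.+1; split=> //; last by rewrite -r0r.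
split.
- move=> i c ri; rewrite (Dge _ _ (ltnW ri)) ltnS leq_eqVlt => /orP[/eqP ck|ck].
    rewrite (_ : c = k0); [exact: Ck | exact: val_inj].
  by rewrite C0 // ltnW.
- move=> i; rewrite ltnS leq_eqVlt => /orP[/eqP ir|ir].
    by exists k0 => //; rewrite (_ : i = r0) //; apply: val_inj; rewrite /= ir r0r.
  by have [c ck lc] := Cl i ir; exists c; [rewrite ltnS ltnW | apply/lD].
- move=> i i' c c' ii'; rewrite ltnS leq_eqVlt => /orP[/eqP ir|ir] lc lc'.
    have e : i' = r0 by apply: val_inj; rewrite /= ir r0r.
    rewrite e in lc'; rewrite (leading_inj lc' lr0); apply: lD' lc.
    by rewrite -ir.
  have ck := lD' _ _ (ltn_trans ii' ir) lc; have ck' := lD' _ _ ir lc'.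
  by apply: (Ce i i'); rewrite ?lD.
- move=> i c; rewrite ltnS leq_eqVlt => /orP[/eqP ir|ir] lc.
    have e : i = r0 by apply: val_inj; rewrite /= ir r0r.
    rewrite e in lc *; rewrite (leading_inj lc lr0) Dge ?r0r //; split=> // i' i'r.
    rewrite mxE /a (leq_trans i'r) ?r0r // mulNr.
    have -> : C i' k0 - (C i' k0 %/ C r0 k0)%Z * C r0 k0 = (C i' k0 %% C r0 k0)%Z by [].
    by rewrite modz_ge0 // ltz_pmod.
  have ck := lD' _ _ ir lc; rewrite Dlt //.
  have [? h] := CP _ _ ir ((lD _ _ ck).2 lc); split=> // i' i'i.
  by rewrite Dlt // h.
Qed.

Lemma SF_exists A : exists S, is_SF A S.
Proof.
have [S [r [AS [S0 Sl Se Sp] _]]] := partial_SF_exists A (leqnn q).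
have ltr (i : 'I_p) c : leading S i c -> (i < r)%N.
  by move=> [nz _]; rewrite ltnNge; apply: contra nz => ri; rewrite S0.
exists S; split=> // [i i' c' ii' lc'|i c lc|i i' c lc].
- have ir' := ltr _ _ lc'; have [c _ lc] := Sl i (ltn_trans ii' ir').
  by exists c => //; apply: Se lc lc'.
- by have [] := Sp i c (ltr _ _ lc) lc.
- by have [_] := Sp i c (ltr _ _ lc) lc; apply.
Qed.

Lemma SFP A : is_SF A (SF A).
Proof. by rewrite /SF; have [S AS] := SF_exists A; apply: (xgetPex 0); exists S. Qed.

Lemma echelon_triangular S (i : 'I_p) (c : 'I_q) : echelon S -> (c < i)%N -> S i c = 0.
Proof.
move=> ech ci.
have lead_ge (j : 'I_p) (d : 'I_q) : leading S j d -> (j <= d)%N.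
  move: {2}(nat_of_ord j) (erefl (nat_of_ord j)) => n.
  elim: n j d => [|n IH] j d jn ld; rewrite jn // .
  have ltn : (n < p)%N by rewrite (leq_trans _ (ltn_ord j)) // jn.
  have [d' d'd ld'] := ech (Ordinal ltn) j d (eq_ind_r (fun x => (n < x)%N) (ltnSn n) jn) ld.
  exact: leq_ltn_trans (IH (Ordinal ltn) _ (erefl n) ld') d'd.
apply/eqP; apply: contraT => nz.
have [d] : exists d : 'I_q, [&& S i d != 0 & [forall e : 'I_q, (e < d)%N ==> (S i e == 0)]].
  pose P d := S i d != 0.
  case: (arg_minnP (P := P) (@nat_of_ord q) nz) => d Pd dmin; exists d; rewrite -/(P d) Pd /=.
  apply/forallP=> e; apply/implyP=> ed; apply: contraLR ed => /dmin.
  by rewrite -leqNgt.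
case/andP=> nd /forallP zd.
have ld : leading S i d by split=> // e ed; apply/eqP; apply: (implyP (zd e)).
have := lead_ge _ _ ld; rewrite leqNgt => /negP[].
apply: leq_ltn_trans ci; rewrite leqNgt; apply/negP => /(implyP (zd c)).
by rewrite (negPf nz).
Qed.

End HermiteForm.

(** The form is triangular with positive entries on the diagonal, which are units;
    so they are 1, and the entries above them vanish, being smaller. *)
Lemma SF_unit p (U S : 'M[int]_p) : U \in unitmx -> is_SF U S -> S = 1%:M.
Proof.
move=> uU [US ech pos red].
have [V uV SV] := row_equiv_unitmx US.
have uS : S \in unitmx by rewrite SV unitmx_mul uV.
have low (i j : 'I_p) : (j < i)%N -> S i j = 0 by apply: echelon_triangular.
have tri : is_trig_mx S^T by apply/is_trig_mxP=> i j ij; rewrite mxE low.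
have udiag i : S i i \is a GRing.unit.
  move: uS; rewrite unitmxE -det_tr det_trig // => /unitr_prodP/(_ i).
  by rewrite mem_index_enum mxE; apply.
have lead i : leading S i i.
  split=> [|j ji]; last exact: low.
  by apply: contraTneq (udiag i) => ->; rewrite unitr0.
have diag1 i : S i i = 1.
  have := pos i i (lead i); case/orP: (udiag i) => /eqP -> //.
apply/matrixP=> i j; rewrite mxE.
case: (ltngtP i j) => ij; last by rewrite (val_inj ij) eqxx.
  have -> : (i == j) = false by apply/negbTE; apply: contraTneq ij => ->; rewrite ltnn.
  by have := red j i j (lead j) ij; rewrite diag1; lia.
have -> : (i == j) = false by apply/negbTE; apply: contraTneq ij => ->; rewrite ltnn.
by rewrite low.
Qed.

(** A unimodular matrix is a product of elementary ones. *)
Lemma unitmx_row_equiv p q (U : 'M[int]_p) (A : 'M[int]_(p, q)) :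
  U \in unitmx -> row_equiv A (U *m A).
Proof.
move=> uU; have uV : invmx U \in unitmx by rewrite unitmx_inv.
have VS := SFP (invmx U); have [VS' _ _ _] := VS.
rewrite (SF_unit uV VS) in VS'.
by have := row_equiv_mulmxr (U *m A) VS'; rewrite mulKmx // mul1mx.
Qed.

(** * Reading off the blocks of the standard echelon form *)

Section Blocks.
Variables (n m : nat) (M : 'M[int]_(m + n, m + (n + n))).
Variable (L : 'M[int]_(m, m + n)).
Hypothesis LM : L *m lsubmx M = 1%:M.

Lemma SF_dlsubmx : dlsubmx (SF M) = 0.
Proof.
have [_ ech _ _] := SFP M; apply/matrixP=> i j; rewrite !mxE.
by apply: echelon_triangular => //=; rewrite ltn_addr.
Qed.

Lemma ulsubmx_SF_unit : ulsubmx (SF M) \in unitmx.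
Proof.
have [/row_equiv_unitmx[U uU SU] _ _ _] := SFP M.
have : L *m invmx U *m lsubmx (SF M) = 1%:M.
  by rewrite SU mulmx_lsub mulmxA mulmxKV // -mulmx_lsub.
have -> : lsubmx (SF M) = col_mx (ulsubmx (SF M)) 0.
  by rewrite -{1}[SF M]submxK block_mxEh row_mxKl SF_dlsubmx.
rewrite -[L *m _]hsubmxK mul_row_col mulmx0 addr0.
by case/mulmx1_unit.
Qed.

Lemma dU_eq1 : dU M = 1.
Proof.
rewrite /dU; have := ulsubmx_SF_unit; rewrite unitmxE.
by case/orP => /eqP ->; rewrite ?normr1 ?normrN1.
Qed.

(** Relations between the endpoint variables only are combinations of the rows of
    [Ml M]; when the left half of [T] is unimodular, so is the change of basis. *)
Lemma Ml_row_equiv (K : 'M[int]_(n, m + n)) (T : 'M[int]_(n, n + n)) :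
  K *m M = row_mx 0 T -> lsubmx T \in unitmx -> row_equiv (Ml M) T.
Proof.
move=> KM uT; have [/row_equiv_unitmx[U uU SU] _ _ _] := SFP M.
pose K' := K *m invmx U.
have : K' *m SF M = row_mx 0 T by rewrite SU mulmxA mulmxKV.
rewrite -[SF M]submxK SF_dlsubmx -[K']hsubmxK mul_row_block mulmx0 addr0.
case/eq_row_mx => /(congr1 (mulmx^~ (invmx (ulsubmx (SF M))))).
rewrite mulmxK ?ulsubmx_SF_unit // mul0mx => ->; rewrite mul0mx add0r => TE.
suff uK : rsubmx K' \in unitmx by rewrite -TE; apply: unitmx_row_equiv.
by move: uT; rewrite -TE -mulmx_lsub unitmx_mul => /andP[].
Qed.

End Blocks.


(** * Euler brackets *)

Lemma lift0_eq0 n (j : 'I_n) : (lift ord0 j == ord0) = false.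
Proof. by []. Qed.

Lemma mem_lift0_imset n (P : {set 'I_n}) (j : 'I_n) :
  (lift ord0 j \in [set lift ord0 i | i in P]) = (j \in P).
Proof. by rewrite mem_imset //; apply: lift_inj. Qed.

Lemma ord0_lift0_imset n (P : {set 'I_n}) :
  (ord0 \in [set lift ord0 i | i in P]) = false.
Proof. by apply/imsetP => -[j _ /eqP]; rewrite eq_sym lift0_eq0. Qed.

(** A subset of [{0, ..., n}] is determined by whether it contains 0 and by its
    trace on [{1, ..., n}]. *)
Lemma big_set_ordS n (F : {set 'I_n.+1} -> int) :
  \sum_(P : {set 'I_n.+1}) F P =
  \sum_(P : {set 'I_n}) F [set lift ord0 i | i in P] +
  \sum_(P : {set 'I_n}) F (ord0 |: [set lift ord0 i | i in P]).
Proof.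
pose tr (P : {set 'I_n.+1}) := [set j : 'I_n | lift ord0 j \in P].
rewrite (bigID (fun P : {set 'I_n.+1} => ord0 \in P)) /= addrC; congr (_ + _).
  rewrite (reindex_onto (fun P : {set 'I_n} => [set lift ord0 i | i in P]) tr).
    apply: eq_bigl => P; rewrite ord0_lift0_imset /=.
    by apply/eqP/setP=> j; rewrite inE mem_lift0_imset.
  move=> P nP; apply/setP => j; case: (unliftP ord0 j) => [i|] ->.
    by rewrite mem_lift0_imset inE.
  by rewrite ord0_lift0_imset (negPf nP).
rewrite (reindex_onto (fun P : {set 'I_n} => ord0 |: [set lift ord0 i | i in P]) tr).
  apply: eq_bigl => P; rewrite !inE eqxx /=.
  by apply/eqP/setP=> j; rewrite !inE lift0_eq0 mem_lift0_imset.
move=> P nP; apply/setP => j; case: (unliftP ord0 j) => [i|] ->.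
  by rewrite !inE lift0_eq0 mem_lift0_imset inE.
by rewrite !inE eqxx nP.
Qed.

Lemma disjoint_pairsP h (P : {set 'I_h}) :
  reflect (forall p, p \in P -> (p.+1 < h)%N /\ forall q : 'I_h, q = p.+1 :> nat -> q \notin P)
          (disjoint_pairs P).
Proof.
apply: (iffP forall_inP) => H p pP; have := H p pP.
  case/andP=> -> /forall_inP h2; split=> // q qp; apply: contraT.
  by rewrite negbK => /h2; rewrite qp eqxx.
case=> -> h2 /=; apply/forall_inP=> q qP; apply: contraTneq qP => e.
exact: h2.
Qed.

Lemma disjoint_pairs_lift n (P : {set 'I_n}) :
  disjoint_pairs [set lift ord0 i | i in P] = disjoint_pairs P.
Proof.
apply/disjoint_pairsP/disjoint_pairsP => H p.
  move=> pP; have [|? h] := H (lift ord0 p); first by rewrite mem_lift0_imset.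
  split=> // q qp; have := h (lift ord0 q); rewrite mem_lift0_imset; apply.
  by rewrite /= /bump /= qp.
case/imsetP=> {}p pP ->; have [? h] := H p pP; split=> // q qp.
case: (unliftP ord0 q) qp => [i|] -> //= [ip].
by rewrite mem_lift0_imset h.
Qed.

(** The pair starting at 0 excludes the one starting at 1. *)
Lemma disjoint_pairs_lift1 n (P : {set 'I_n}) :
  disjoint_pairs (ord0 |: [set lift ord0 i | i in ord0 |: [set lift ord0 i | i in P]])
  = false.
Proof.
apply/negP => /disjoint_pairsP/(_ ord0); rewrite !inE eqxx => -[//|_].
move/(_ (lift ord0 ord0) (erefl _)).
by rewrite !inE mem_lift0_imset !inE eqxx orbT.
Qed.

(** If no pair starts at 1, the one starting at 0 does not constrain the others. *)
Lemma disjoint_pairs_lift2 n (P : {set 'I_n}) :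
  disjoint_pairs (ord0 |: [set lift ord0 i | i in [set lift ord0 i | i in P]])
  = disjoint_pairs P.
Proof.
rewrite -[RHS](disjoint_pairs_lift P) -[RHS]disjoint_pairs_lift.
set Q := [set lift ord0 i | i in [set _ | _ in _]].
apply/disjoint_pairsP/disjoint_pairsP => H p.
  move=> pQ; have [|? h] := H p; first by rewrite !inE pQ orbT.
  by split=> // q /h; rewrite !inE negb_or => /andP[].
rewrite in_setU1 => /orP[/eqP ->|pQ].
  split=> // q q1; rewrite !inE negb_or; apply/andP; split.
    by apply/eqP => e; rewrite e in q1.
  case: (unliftP ord0 q) q1 => [i|] -> //= [i0].
  rewrite mem_lift0_imset (_ : i = ord0) ?ord0_lift0_imset //.
  exact: val_inj.
have [? h] := H p pQ; split=> // q qp; rewrite !inE negb_or h // andbT.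
by apply/eqP => e; rewrite e in qp.
Qed.

Lemma omittedP h (P : {set 'I_h}) (j : 'I_h) :
  reflect (exists2 p, p \in P & (j == p) || (j == p.+1 :> nat)) (omitted P j).
Proof. exact: exists_inP. Qed.

Lemma omitted_lift n (P : {set 'I_n}) (j : 'I_n) :
  omitted [set lift ord0 i | i in P] (lift ord0 j) = omitted P j.
Proof.
apply/omittedP/omittedP => -[p].
  by case/imsetP=> {}p pP -> h; exists p.
by move=> pP h; exists (lift ord0 p); rewrite ?mem_lift0_imset.
Qed.

Lemma omitted_lift0 n (P : {set 'I_n}) :
  omitted [set lift ord0 i | i in P] ord0 = false.
Proof. by apply/negbTE/negP => /omittedP[p /imsetP[q _ ->]]. Qed.

Lemma omitted_lift2 n (P : {set 'I_n}) (j : 'I_n.+2) :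
  omitted (ord0 |: [set lift ord0 i | i in [set lift ord0 i | i in P]]) j =
  (j <= 1)%N || omitted [set lift ord0 i | i in [set lift ord0 i | i in P]] j.
Proof.
apply/omittedP/orP.
  move=> [p]; rewrite in_setU1 => /orP[/eqP ->|pP] h.
    by left; case/orP: h => /eqP ->.
  by right; apply/omittedP; exists p.
case=> [j1|/omittedP[p pP h]]; last by exists p => //; rewrite !inE pP orbT.
exists ord0; rewrite ?inE ?eqxx // -!val_eqE /=.
by case: (nat_of_ord j) j1 => [|[]].
Qed.

Lemma euler_nil : euler [::] = 1.
Proof.
rewrite /euler (big_pred1 (finset.set0 : {set _})) => [|P]; first by rewrite big_ord0.
have -> : P = finset.set0 by apply/setP; case.
by rewrite /= eqxx; apply/disjoint_pairsP=> p; rewrite inE.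
Qed.

Lemma euler_single a : euler [:: a] = a.
Proof.
rewrite /euler (big_pred1 (finset.set0 : {set _})) => [|P].
  rewrite big_mkcond big_ord_recl big_ord0 ifT /= ?mulr1 //.
  by apply/negP => /omittedP[p]; rewrite inE.
apply/disjoint_pairsP/eqP => [H|->]; last by move=> p; rewrite inE.
by apply/setP => p; rewrite inE; apply/negP => /H; rewrite ltnS leqNgt ltnS leq0n => -[].
Qed.

(** The subsets without 0 keep the factor [a], those with 0 omit [a] and [b]. *)
Lemma euler_cons2 a b (s : seq int) :
  euler [:: a, b & s] = a * euler (b :: s) + euler s.
Proof.
rewrite {1}/euler big_mkcond big_set_ordS; congr (_ + _).
  rewrite /euler mulr_sumr [RHS]big_mkcond; apply: eq_bigr => P _.
  rewrite disjoint_pairs_lift; case: ifP => // _.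
  rewrite big_mkcond big_ord_recl omitted_lift0 [in RHS]big_mkcond; congr (_ * _).
  by apply: eq_bigr => j _; rewrite omitted_lift.
rewrite big_set_ordS [X in _ + X]big1 ?addr0; last first.
  by move=> P _; rewrite disjoint_pairs_lift1.
rewrite /euler [RHS]big_mkcond; apply: eq_bigr => P _.
rewrite disjoint_pairs_lift2; case: ifP => // _.
rewrite big_mkcond 2!big_ord_recl !omitted_lift2 /= !mul1r [RHS]big_mkcond.
by apply: eq_bigr => j _; rewrite omitted_lift2 !omitted_lift.
Qed.

Lemma euler_rcons1 (s : seq int) (a : int) :
  euler (rcons (rcons s a) 1) = euler (rcons s a) + euler s.
Proof.
have [n] := ubnP (size s); elim: n s => // n IH [|b [|c s]] /= ltn.
- by rewrite euler_cons2 !euler_single euler_nil mulr1.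
- by rewrite !euler_cons2 !euler_single euler_nil; ring.
rewrite !euler_cons2 (IH s (ltnW ltn)).
by have /= -> := IH (c :: s) ltn; ring.
Qed.

(** * The action of braid words on colourings *)

(** A colouring of a vertical slice assigns to each position the colour [f p] of
    the arc there.  Past the letter [l], the overstrand keeps its colour [x]
    and the understrand goes from [y] to [2 x - y]. *)
Definition letter_act (V : zmodType) (f : nat -> V) (l : letter) : nat -> V :=
  let: (g, e) := l in
  let start := if e then g.+1 else g in
  let stop := if e then g else g.+1 in
  fun p => if p == stop then f start
           else if p == start then f start *+ 2 - f stop else f p.

(** The colouring to the right of the word [w], for [f] to its left. *)
Definition word_act (V : zmodType) (f : nat -> V) (w : seq letter) : nat -> V :=
  foldl (@letter_act V) f w.

Lemma word_act_cat (V : zmodType) (f : nat -> V) w1 w2 :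
  word_act f (w1 ++ w2) = word_act (word_act f w1) w2.
Proof. exact: foldl_cat. Qed.

Lemma eq_word_act (V : zmodType) (f1 f2 : nat -> V) w :
  f1 =1 f2 -> word_act f1 w =1 word_act f2 w.
Proof.
elim: w f1 f2 => [//|[g e] w IH] f1 f2 f12 /=; apply: IH => p.
by rewrite /= !f12.
Qed.

Lemma word_act_morph (V W : zmodType) (h : V -> W) (f : nat -> V) w p :
  {morph h : x y / x + y} -> {morph h : x y / x - y} ->
  h (word_act f w p) = word_act (fun q => h (f q)) w p.
Proof.
move=> hD hB; elim: w f => [//|[g e] w IH] f /=; rewrite IH; apply: eq_word_act => q /=.
by case: ifP => // _; case: ifP => // _; rewrite hB !mulr2n hD.
Qed.

(** Each crossing of a syllable adds the difference of the two colours to both,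
    up to sign, which leaves the difference unchanged. *)
Lemma word_act_gen_pow (f : nat -> int) g a p :
  word_act f (gen_pow g a) p =
  if (p == g) || (p == g.+1) then f p + a * (f g.+1 - f g) else f p.
Proof.
have H n e : word_act f (nseq n (g, e)) p =
    if (p == g) || (p == g.+1)
    then f p + (if e then n%:Z else - n%:Z) * (f g.+1 - f g) else f p.
  elim: n f => [|n IH] f /=; first by rewrite oppr0 if_same mul0r addr0 if_same.
  have ng : (g.+1 == g) = false by apply/negbTE; rewrite neq_ltn ltnSn orbT.
  have gn : (g == g.+1) = false by rewrite eq_sym.
  rewrite IH intS; case: e {IH} => /=; rewrite !eqxx ?ng ?gn;
  have [pg|pg] := eqVneq p g; have [pg1|pg1] := eqVneq p g.+1;
  rewrite /= ?pg // -?pg1; try by [ring | lia].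
rewrite /gen_pow H; case: ifP => // _; congr (_ + _ * _).
by case: ifP; lia.
Qed.

(** The word [sigma_1^(-a_1) sigma_2^(a_2) ...], or [sigma_2^(a_1) sigma_1^(-a_2) ...]
    if [b] holds. *)
Fixpoint alternating_word (b : bool) (s : seq int) : seq letter :=
  if s is a :: s' then
    (if b then gen_pow 2 a else gen_pow 1 (- a)) ++ alternating_word (~~ b) s'
  else [::].

Lemma three_braid_wordE c : three_braid_word c = alternating_word false c.
Proof.
have H b : flatten [seq if odd k (+) b then gen_pow 2 c`_k else gen_pow 1 (- c`_k)
          | k <- iota 0 (size c)] = alternating_word b c.
  elim: c b => [//|a c IH] b /=; congr (_ ++ _); rewrite -IH (iotaDl 1 0) -map_comp.
  by congr flatten; apply: eq_map => k /=; rewrite addbN addNb.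
by rewrite -H /three_braid_word; congr flatten; apply: eq_map => k; rewrite addbF.
Qed.

Lemma alternating_word_sum (f : nat -> int) b s :
  let f' := word_act f (alternating_word b s) in f' 1 - f' 2 + f' 3 = f 1 - f 2 + f 3.
Proof.
elim: s f b => [//|a s IH] f b /=; rewrite word_act_cat IH.
by case: b; rewrite !word_act_gen_pow /=; ring.
Qed.

Lemma euler_cons a s : s != [::] -> euler (a :: s) = a * euler s + euler (behead s).
Proof. by case: s => // b s _; rewrite euler_cons2. Qed.

Lemma euler_cons_take a s : s != [::] ->
  euler (a :: take (size s).-1 s) = a * euler (take (size s).-1 s) + euler_inner s.
Proof.
case: s => [//|b [|c s]] _; rewrite /euler_inner.
  by rewrite /= euler_single euler_nil; ring.
by rewrite /= euler_cons2.
Qed.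

(** The two differences of adjacent colours, the one fixed by the first
    syllable first, expressed through the final differences. *)
Lemma alternating_word_diff (f : nat -> int) b s :
  s != [::] ->
  let f' := word_act f (alternating_word b s) in
  let D1 (h : nat -> int) := h 2 - h 1 in
  let D2 (h : nat -> int) := h 3 - h 2 in
  let sg : int := if odd (size s) then 1 else -1 in
  let v' := if odd (size s) (+) b then D1 f' else D2 f' in
  let u' := if odd (size s) (+) b then D2 f' else D1 f' in
  (if b then D2 f else D1 f) = sg * (euler (behead s) * v' - euler_inner s * u') /\
  (if b then D1 f else D2 f) =
    - (sg * (euler s * v' - euler (take (size s).-1 s) * u')).
Proof.
elim: s f b => [//|a s IH] f b _ /=.
have [->|s0] := eqVneq s [::].
  rewrite /= euler_nil euler_single /euler_inner /= cats0.
  by case: b; rewrite /= !word_act_gen_pow /=; split; ring.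
rewrite word_act_cat; set g := word_act f (if b then _ else _).
have [/= E1 E2] := IH g (~~ b) s0.
set f' := word_act g _ in E1 E2 *.
have ob : odd (size s) (+) ~~ b = ~~ odd (size s) (+) b by rewrite addbN addNb.
rewrite ob in E1 E2.
rewrite euler_cons //.
have -> : take (size s) (a :: s) = a :: take (size s).-1 s by case: (s) s0.
have -> : euler_inner (a :: s) = euler (take (size s).-1 s).
  by rewrite /euler_inner /= eqSS size_eq0 (negPf s0); case: (s) s0.
rewrite euler_cons_take //.
have -> : (if ~~ odd (size s) then 1 else -1) = - (if odd (size s) then 1 else -1) :> int.
  by case: odd.
move: E1 E2; set sg := if odd _ then 1 else _; set v' := if _ (+) b then _ - f' 1 else _.
set u' := if _ (+) b then _ - f' 2 else _ => E1 E2.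
have [G1 G2] : (if b then g 3 - g 2 else g 2 - g 1) = (if b then f 3 - f 2 else f 2 - f 1)
   /\ (if b then g 2 - g 1 else g 3 - g 2) =
      (if b then f 2 - f 1 else f 3 - f 2) + a * (if b then f 3 - f 2 else f 2 - f 1).
  by rewrite /g; case: (b); rewrite !word_act_gen_pow /=; split; ring.
have F1 : (if b then g 3 - g 2 else g 2 - g 1) =
    - (sg * (euler s * v' - euler (take (size s).-1 s) * u')).
  by rewrite -E2; case: (b).
have F2 : (if b then g 2 - g 1 else g 3 - g 2) =
    sg * (euler (behead s) * v' - euler_inner s * u').
  by rewrite -E1; case: (b).
move: G2; rewrite -G1 F1 F2 => G2; split; first by ring.
by rewrite -[LHS](addrK (a * - (sg * (euler s * v' - euler (take (size s).-1 s) * u')))) -G2; ring.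
Qed.

(** The rows of [three_braid_matrix c] are relations between the colours at the
    two ends of the braid. *)
Lemma three_braid_matrix_relations (f : nat -> int) c (r : 'I_3) : odd (size c) ->
  \sum_(j < 3) three_braid_matrix c r (lshift 3 j) * f j.+1 +
  \sum_(j < 3) three_braid_matrix c r (rshift 3 j)
     * word_act f (three_braid_word c) j.+1 = 0.
Proof.
move=> oc; have c0 : c != [::] by apply: contraTneq oc => ->.
rewrite three_braid_wordE.
have S := alternating_word_sum f false c.
have [/=] := alternating_word_diff f false c0; rewrite oc /= !mul1r => D1 D2.
move: S D1 D2 => /=; set f' := word_act _ _ => S D1 D2.
have H1 : euler (1 :: rcons c 1) = euler (1 :: c) + euler (1 :: take (size c).-1 c).
  case: (lastP c) c0 => // s a _; rewrite -!rcons_cons euler_rcons1.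
  by rewrite size_rcons /= -cats1 take_size_cat.
have H2 : euler (rcons (behead c) 1) = euler (behead c) + euler_inner c.
  rewrite /euler_inner; case: (c) c0 => // a s _ /=.
  case: (lastP s) => [|s' b]; first by rewrite euler_single euler_nil.
  rewrite euler_rcons1 eqSS size_rcons /=; congr (_ + _).
  by rewrite -cats1 take_size_cat.
have D : f 2 = f' 1 - f' 2 + f' 3 + ((f 2 - f 1) - (f 3 - f 2)) by lia.
have {}D1 : f 2 - f 1 = euler (behead c) * (f' 2 - f' 1) - euler_inner c * (f' 3 - f' 2).
  by [].
have E1 := euler_cons 1 c0; have E2 := euler_cons_take 1 c0; rewrite !mul1r in E1 E2.
have {}D2 : f 2 = f' 1 - f' 2 + f' 3 + euler (1 :: c) * (f' 2 - f' 1)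
                  - euler (1 :: take (size c).-1 c) * (f' 3 - f' 2).
  by rewrite D D1 D2 E1 E2; ring.
rewrite !big_ord_recl !big_ord0 !mxE /= H1 H2.
have {}S : f 3 = f' 1 - f' 2 + f' 3 + (f 2 - f 1) by lia.
case: r => -[|[|[|//]]] lr /=; rewrite /bump /= (_ : (1 + 1).+1%N = 3%N) //.
- by rewrite S; ring.
- by rewrite D2; ring.
- by rewrite S D1; ring.
Qed.


(** * Undercrossings along a string *)

Lemma finite_set_max (R : realType) (A : set R) : finite_set A -> (A !=set0)%classic ->
  exists2 x, A x & forall y, A y -> y <= x.
Proof.
move=> finA [x Ax].
have H (s : seq R) : s != [::] -> exists2 y, y \in s & {in s, forall z, z <= y}.
  elim: s => [//|a s IH] _; have [->|/IH[y ys ymax]] := eqVneq s [::].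
    by exists a => [|z]; rewrite inE ?eqxx // => /eqP ->.
  have [ay|ya] := leP a y.
    exists y => [|z]; first by rewrite inE ys orbT.
    by rewrite inE => /orP[/eqP ->|/ymax].
  exists a => [|z]; first by rewrite inE eqxx.
  by rewrite inE => /orP[/eqP ->//|/ymax zy]; apply: le_trans zy (ltW ya).
have sP y : (y \in enum_fset (fset_set A)) = (y \in A) by apply: in_fset_set.
have [|y] := H (enum_fset (fset_set A)).
  by apply/eqP => s0; have := sP x; rewrite s0 (mem_set Ax).
rewrite sP => /set_mem Ay ymax; exists y => // z Az.
by apply: ymax; rewrite sP mem_set.
Qed.

Section Undercrossings.
Variables (R : realType) (n : nat) (B : tangle R n).
Hypothesis reg : regular B.
Implicit Types (i j : 'I_n) (s t u : R).

Lemma finite_under i : finite_set [set u | under B i u]%classic.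
Proof.
case: reg => fin _ _ _ _.
apply: sub_finite_set (finite_image (fun pq => pq.1.2) fin) => u [q [dp _]].
by exists ((i, u), q).
Qed.

Lemma finite_under_lt i s : finite_set [set u | under B i u /\ u < s]%classic.
Proof. by apply: sub_finite_set (finite_under i) => u []. Qed.

Lemma under_gt0_lt1 i u : under B i u -> 0 < u < 1.
Proof. by case=> q [dp _]; case: reg => _ _ H _ _; apply: H dp. Qed.

Lemma arc_index_const i s t : s <= t ->
  (forall u, s <= u -> u < t -> ~ under B i u) -> arc_index B i s = arc_index B i t.
Proof.
move=> st nou; rewrite /arc_index; congr (#|` fset_set _|%fset).
apply/seteqP; split=> u [Uu us]; split=> //; first exact: lt_le_trans us st.
by rewrite ltNge; apply/negP => su; apply: (nou u).
Qed.

Lemma arc_index_eq0 i s : (forall u, under B i u -> s <= u) -> arc_index B i s = 0%N.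
Proof.
move=> h; rewrite /arc_index (_ : [set u | _]%classic = set0) ?fset_set0 ?cardfs0 //.
by apply/seteqP; split=> // u [/h su]; rewrite ltNge su.
Qed.

Lemma arc_index_nunder i s : 1 <= s -> arc_index B i s = nunder B i.
Proof.
move=> s1; rewrite /arc_index /nunder; congr (#|` fset_set _|%fset).
apply/seteqP; split=> [u []//|u Uu]; split=> //.
by have /andP[_ u1] := under_gt0_lt1 Uu; apply: lt_le_trans u1 s1.
Qed.

Lemma leq_arc_index i s t : s <= t -> (arc_index B i s <= arc_index B i t)%N.
Proof.
move=> st; apply: fsubset_leq_card.
rewrite -fset_set_sub; [|exact: finite_under_lt..].
by move=> u [Uu us]; split=> //; apply: lt_le_trans us st.
Qed.

Lemma arc_index_leq_nunder i s : (arc_index B i s <= nunder B i)%N.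
Proof.
apply: fsubset_leq_card.
rewrite -fset_set_sub; [by move=> u []|exact: finite_under_lt|exact: finite_under].
Qed.

Lemma arc_indexS i s t : under B i s -> s < t ->
  (forall u, s < u -> u < t -> ~ under B i u) -> arc_index B i t = (arc_index B i s).+1.
Proof.
move=> Us st nou; rewrite /arc_index.
have -> : ([set u | under B i u /\ u < t] =
           s |` [set u | under B i u /\ u < s])%classic.
  apply/seteqP; split=> u.
    case=> Uu ut; have [us|su|->] := ltgtP u s; [by right|by case: (nou u)|by left].
  by case=> [->|[Uu us]]; split=> //; apply: lt_trans us st.
rewrite fset_setU1; last exact: finite_under_lt.
rewrite cardfsU1 in_fset_set; last exact: finite_under_lt.
by rewrite memNset //= => -[_]; rewrite ltxx.
Qed.

(** The point where the arc containing the point [s] starts. *)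
Lemma arc_start i s : (0 < arc_index B i s)%N ->
  exists u, [/\ under B i u, u < s & arc_index B i s = (arc_index B i u).+1].
Proof.
move=> pos; have [|u [Uu us] umax] := finite_set_max (finite_under_lt i s).
  apply/set0P; apply: contraTneq pos => e.
  by rewrite /arc_index e fset_set0 cardfs0.
exists u; split=> //; apply: arc_indexS => // v uv vs Uv.
by have := umax v (conj Uv vs); rewrite leNgt uv.
Qed.

Lemma arc_index_onto i a : (a <= nunder B i)%N -> exists s, arc_index B i s = a.
Proof.
rewrite -(arc_index_nunder i (lexx 1)).
move: {2}(arc_index B i 1) (erefl (arc_index B i 1)) => k.
elim: k 1 => [|k IH] s sk; rewrite sk => ak.
  by exists s; rewrite sk; apply/esym/eqP; rewrite -leqn0.
move: ak; rewrite leq_eqVlt => /orP[/eqP ->|ak]; first by exists s.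
have [|u [_ _ su]] := @arc_start i s; first by rewrite sk.
have uk : arc_index B i u = k by apply/eqP; rewrite -eqSS -su sk.
by apply: (IH u uk); rewrite uk.
Qed.

Lemma crossing_uniq p q r : crossing B p q -> crossing B p r -> q = r.
Proof. by move=> [dq _] [dr _]; case: reg => _ H _ _ _; apply: H dq dr. Qed.

End Undercrossings.

(** * Crossings of a braid *)

Section BraidCrossings.
Variables (R : realType) (n : nat) (B : tangle R n).
Hypotheses (reg : regular B) (braid : is_braid B).
Implicit Types (i j : 'I_n) (s t u : R).

Lemma double_point_level p q : double_point B p q -> p.2 = q.2.
Proof.
by move=> [_ p01 q01 + _]; rewrite (braid _ p01).1 (braid _ q01).1.
Qed.

Lemma double_point_sym p q : double_point B p q -> double_point B q p.
Proof. by move=> [pq p01 q01 lpq ppq]; split=> //; apply: nesym. Qed.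

Lemma double_pointI i j s : i != j -> 0 <= s <= 1 -> pos B i s = pos B j s ->
  double_point B (i, s) (j, s).
Proof.
move=> /eqP ij s01 pij; split=> //=; first by case.
by rewrite !(braid _ s01).1.
Qed.

Lemma crossing_or i j s : i != j -> 0 <= s <= 1 -> pos B i s = pos B j s ->
  crossing B (i, s) (j, s) \/ crossing B (j, s) (i, s).
Proof.
move=> ij s01 pij; have dp := double_pointI ij s01 pij.
have [h|h|h] := ltgtP (hgt B i s) (hgt B j s); [by left|right|].
  by split=> //; apply: double_point_sym.
have [] := @strings_embedded _ _ B i j s s s01 s01 _ pij h.
  by rewrite !(braid _ s01).1.
by move=> e; rewrite e eqxx in ij.
Qed.

(** No string passes under another one at level [t]. *)
Definition uncrossed t := forall i, ~ under B i t.

Lemma uncrossed_neq i j t : i != j -> 0 <= t <= 1 -> uncrossed t ->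
  pos B i t != pos B j t.
Proof.
move=> ij t01 nc; apply/eqP => /(crossing_or ij t01).
by case=> c; [apply: (nc i)|apply: (nc j)]; eexists; apply: c.
Qed.

(** By the intermediate value theorem, two strings cannot exchange their order
    without meeting. *)
Lemma pos_lt_const i j s t : 0 <= s -> s <= t -> t <= 1 ->
  (forall u, s <= u <= t -> pos B i u != pos B j u) ->
  (pos B j s < pos B i s) = (pos B j t < pos B i t).
Proof.
move=> s0 st t1 neq; pose f u := pos B i u - pos B j u.
have fc : {within `[s, t], continuous f}%classic.
  apply: (@continuous_subspaceW _ _ `[s, t]%classic `[0, 1]%classic).
    move=> u /=; rewrite !in_itv /= => /andP[su ut].
    by rewrite (le_trans s0 su) (le_trans ut t1).
  by apply: within_continuousB; [exact: pos_cont|exact: pos_cont].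
have fn0 u : s <= u <= t -> f u != 0 by move=> /neq; rewrite subr_eq0.
have nIVT : ~ (Num.min (f s) (f t) <= 0 <= Num.max (f s) (f t)).
  move=> /(IVT st fc)[c]; rewrite in_itv /= => /fn0 /eqP; apply.
have fs : f s != 0 by apply: fn0; rewrite lexx.
have ft : f t != 0 by apply: fn0; rewrite lexx st.
rewrite -subr_gt0 -(subr_gt0 (pos B j t)) -/(f s) -/(f t).
move: nIVT fs ft; rewrite ge_min le_max.
by case: (ltgtP 0 (f s)); case: (ltgtP 0 (f t)).
Qed.

Lemma position_const i s t : 0 <= s -> s <= t -> t <= 1 ->
  (forall j u, j != i -> s <= u <= t -> pos B i u != pos B j u) ->
  position B i s = position B i t.
Proof.
move=> s0 st t1 neq; rewrite /position; congr (_.+1); apply: eq_card => j.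
rewrite !inE; have [->|ji] := eqVneq j i; first by rewrite !ltxx.
by apply: pos_lt_const => // u; apply: neq.
Qed.

Lemma position_inj i j t : 0 <= t <= 1 -> uncrossed t ->
  position B i t = position B j t -> i = j.
Proof.
move=> t01 nc; have lt_pos a b : pos B a t < pos B b t ->
    (position B a t < position B b t)%N.
  move=> ab; rewrite ltnS; apply: proper_card; apply/properP; split.
    by apply/fintype.subsetP => k; rewrite !inE => /lt_trans; apply.
  by exists a; rewrite !inE ?ltxx.
move=> pij; apply/eqP; apply: contraT => ij.
have := uncrossed_neq ij t01 nc.
by case: ltgtP => // /lt_pos; rewrite pij ltnn.
Qed.

Lemma position_leq i t : (position B i t <= n)%N.
Proof.
rewrite /position -[X in (_ <= X)%N]card_ord; apply: proper_card; apply/properP.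
by split; [apply/fintype.subsetP|exists i; rewrite ?inE ?ltxx].
Qed.

End BraidCrossings.

(** * Colours modulo the rows of the coloring matrix *)

(** [w] is an integer combination of the rows of [M]. *)
Definition in_rowspan p q (M : 'M[int]_(p, q)) (w : 'rV[int]_q) : Prop :=
  exists y : 'rV_p, w = y *m M.

Section Rowspan.
Variables (p q : nat) (M : 'M[int]_(p, q)).
Implicit Types v w : 'rV[int]_q.

Lemma in_rowspan0 : in_rowspan M 0.
Proof. by exists 0; rewrite mul0mx. Qed.

Lemma in_rowspanD v w : in_rowspan M v -> in_rowspan M w -> in_rowspan M (v + w).
Proof. by move=> [y ->] [z ->]; exists (y + z); rewrite mulmxDl. Qed.

Lemma in_rowspanZ a w : in_rowspan M w -> in_rowspan M (a *: w).
Proof. by move=> [y ->]; exists (a *: y); rewrite scalemxAl. Qed.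

Lemma in_rowspanN w : in_rowspan M w -> in_rowspan M (- w).
Proof. by rewrite -scaleN1r; apply: in_rowspanZ. Qed.

Lemma in_rowspanB v w : in_rowspan M v -> in_rowspan M w -> in_rowspan M (v - w).
Proof. by move=> ? ?; apply: in_rowspanD => //; apply: in_rowspanN. Qed.

Lemma in_rowspan_sum (I : finType) (F : I -> 'rV[int]_q) :
  (forall i, in_rowspan M (F i)) -> in_rowspan M (\sum_i F i).
Proof. by move=> h; apply: big_ind => //; [exact: in_rowspan0|exact: in_rowspanD]. Qed.

Lemma in_rowspan_row i : in_rowspan M (row i M).
Proof. by exists (delta_mx 0 i); rewrite rowE. Qed.

Lemma in_rowspan_rows r (N : 'M[int]_(r, q)) :
  (forall i, in_rowspan M (row i N)) -> exists K : 'M[int]_(r, p), K *m M = N.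
Proof.
move=> /fin_all_exists[y yE]; exists (\matrix_i y i).
by apply/row_matrixP => i; rewrite row_mul rowK -yE.
Qed.

End Rowspan.

Section Coloring.
Variables (R : realType) (n : nat) (B : tangle R n) (eo : 'I_(n + n) -> endpoint n).
Variables (m : nat) (M : 'M[int]_(m + n, m + (n + n))).
Hypotheses (reg : regular B).

(** What is needed of the map [e] sending a variable [v] to the row vector with a
    single 1, in the column of [v].  Modulo the rows of [M], [e v] is the colour of
    the arc of [v] in the universal colouring.  In a crossing equation the overarc
    may be taken to be [arc_index]: when its string is a single arc, the two
    variables agree modulo the rows. *)
Definition arc_vectors (e : tvar n -> 'rV[int]_(m + (n + n))) : Prop :=
  [/\ forall k, e (endpoint_var B (eo k)) = delta_mx 0 (rshift m k),
      forall c, exists2 v, is_var B v & e v = delta_mx 0 c,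
      forall i u q, crossing B (i, u) q ->
        in_rowspan M (e (i, arc_index B i u) + e (i, (arc_index B i u).+1)
                      - 2 *: e (q.1, arc_index B q.1 q.2))
    & forall i, nunder B i = 0%N -> in_rowspan M (e (i, 0%N) - e (i, 1%N))].

Lemma coloring_arc_vectors : is_coloring_matrix B eo M -> exists e, arc_vectors e.
Proof.
move=> [var [eqn [[vinj vrange] vend [_ erange] coefs]]].
pose e (v : tvar n) : 'rV[int]_(m + (n + n)) := \row_c (var c == v)%:R.
have evar c : e (var c) = delta_mx 0 c.
  by apply/rowP => k; rewrite !mxE eqxx (inj_eq vinj).
have eqnP q : is_equation B q -> exists r, eqn r = q.
  move=> eq; have : [set q | is_equation B q]%classic q by [].
  by rewrite -erange => -[r _ rq]; exists r.
have single i : nunder B i = 0%N -> in_rowspan M (e (i, 0%N) - e (i, 1%N)).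
  move=> ni; have [r rE] := eqnP (SingleArcEq R i) ni.
  have [coef [+ Mr]] := coefs r; rewrite rE /= => cE.
  suff -> : e (i, 0%N) - e (i, 1%N) = row r M by apply: in_rowspan_row.
  by apply/rowP => c; rewrite !mxE Mr cE.
exists e; split=> //.
- by move=> k; rewrite -vend evar.
- move=> c; exists (var c) => //.
  have : range var (var c) by exists c.
  by rewrite vrange.
move=> i u q cr; have [r rE] := eqnP (CrossingEq i u) (ex_intro _ q cr).
have [coef [+ Mr]] := coefs r; rewrite rE /= => -[q' [x [cr' [x1 x2] cE]]].
rewrite (crossing_uniq reg cr cr'); move: x1 x2 => {cr q}; set q := q' => x1 x2.
have H1 : in_rowspan M (e (i, arc_index B i u) + e (i, (arc_index B i u).+1) - 2 *: e x).
  set w := _ - _; suff -> : w = row r M by apply: in_rowspan_row.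
  by apply/rowP => c; rewrite !mxE Mr cE.
have H2 : in_rowspan M (e x - e (q.1, arc_index B q.1 q.2)).
  case: x x1 x2 {cE H1} => x1 x2 /= ->; case: eqP => [n0|_ /eqP ->]; last first.
    by rewrite subrr; apply: in_rowspan0.
  have -> : arc_index B q.1 q.2 = 0%N.
    by apply/eqP; rewrite -leqn0 -n0 arc_index_leq_nunder.
  case: x2 => [|[|//]] _; first by rewrite subrr; apply: in_rowspan0.
  by rewrite -opprB; apply/in_rowspanN/single.
have -> : 2 *: e (q.1, arc_index B q.1 q.2) =
          2 *: e x - 2 *: (e x - e (q.1, arc_index B q.1 q.2)).
  by rewrite scalerBr opprB addrC subrK.
by rewrite opprB addrCA; apply: in_rowspanD => //; apply: in_rowspanZ.
Qed.

Section ArcVectors.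
Variable e : tvar n -> 'rV[int]_(m + (n + n)).
Hypotheses (eP : arc_vectors e) (braid : is_braid B).

(** The colour of string [i] at level [t]; at an undercrossing, that of the arc
    ending there. *)
Definition colour i t := e (i, arc_index B i t).

(** The colour of string [i] past a single undercrossing, at level [u]. *)
Lemma colour_under i j u s t : crossing B (i, u) (j, u) ->
  s <= u -> u < t -> (forall v, s <= v -> v < t -> v != u -> ~ under B i v) ->
  in_rowspan M (colour i t - (colour j u *+ 2 - colour i s)).
Proof.
move=> cr su ut nov; have [_ _ /(_ _ _ _ cr) /= + _] := eP.
have Ui : under B i u by exists (j, u).
have -> : colour i t = e (i, (arc_index B i u).+1).
  rewrite /colour (@arc_indexS _ _ _ reg i u t) // => v uv vt.
  by apply: nov vt _; rewrite ?(le_trans su (ltW uv)) ?gt_eqF.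
have -> : colour i s = e (i, arc_index B i u).
  rewrite /colour (@arc_index_const _ _ _ i s u) // => v sv vu.
  by apply: nov sv (lt_trans vu ut) _; rewrite lt_eqF.
by rewrite /colour opprB addrA -scaler_nat [X in in_rowspan M (X - _)]addrC.
Qed.

(** Going from left to right, every colour is an integer combination of endpoint
    colours: by induction on the number of undercrossings to the left. *)
Lemma colour_generated : bijective eo ->
  forall v, is_var B v -> exists z, in_rowspan M (e v - row_mx 0 z).
Proof.
move=> [oe _ eoK]; have [eend _ _ esingle] := eP.
(* P w: w is a combination of endpoint colours. *)
pose P w := exists z : 'rV[int]_(n + n), in_rowspan M (w - row_mx 0 z).
have PB v w : P v -> P w -> P (v - w).
  move=> [y vy] [z wz]; exists (y - z).
  have -> : row_mx 0 (y - z) = row_mx 0 y - row_mx 0 z :> 'rV[int]_(m + (n + n)).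
    by rewrite opp_row_mx add_row_mx subrr.
  rewrite (_ : _ - _ = (v - row_mx 0 y) - (w - row_mx 0 z)); first exact: in_rowspanB.
  by rewrite !opprD addrACA.
have P2 w : P w -> P (w *+ 2).
  move=> Pw; have P00 : P 0 by exists 0; rewrite row_mx0 subrr; apply: in_rowspan0.
  by rewrite mulr2n -[X in _ + X]opprK -[- w]add0r; apply: (PB _ _ Pw (PB _ _ P00 Pw)).
have Prow v w : in_rowspan M (v - w) -> P w -> P v.
  move=> vw [z wz]; exists z; have := in_rowspanD vw wz.
  by rewrite addrA subrK.
have P0 i : P (e (i, 0%N)).
  have := eend (oe (i, false)); rewrite eoK /= => ->.
  exists (delta_mx 0 (oe (i, false))).
  by rewrite delta_mx_rshift subrr; apply: in_rowspan0.
have Pcol i t : P (colour i t).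
  move: {2}(\sum_j arc_index B j t)%N (leqnn (\sum_j arc_index B j t)) => k.
  elim: k i t => [|k IH] i t tk.
    have -> : colour i t = e (i, 0%N); last exact: P0.
    move: tk; rewrite (bigD1 i) //= leqn0 addn_eq0 => /andP[/eqP ti _].
    by rewrite /colour ti.
  have [t0|tpos] := posnP (arc_index B i t); first by rewrite /colour t0; apply: P0.
  have [u [[[j u'] cr] ut tu]] := arc_start reg tpos.
  have uu' : u = u' by apply: (double_point_level braid (proj1 cr)).
  subst u'.
  have Plt j' : P (colour j' u).
    apply: IH; rewrite -ltnS; apply: leq_trans tk.
    rewrite (bigD1 i) //= [X in (_ < X)%N](bigD1 i) //= tu addSn ltnS.
    by rewrite leq_add2l; apply: leq_sum => j'' _; apply: leq_arc_index => //; apply: ltW.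
  apply: Prow (PB _ _ (P2 _ (Plt j)) (Plt i)).
  have [_ _ /(_ _ _ _ cr) /= + _] := eP.
  by rewrite /colour tu opprB addrA -scaler_nat [X in in_rowspan M (X - _)]addrC.
move=> [i a] /=; rewrite /is_var /last_arc /= leq_max => /orP[|/(arc_index_onto reg)[s <-]].
  case: (posnP (nunder B i)) => [n0|npos] a1; last first.
    by have [|s <-] := @arc_index_onto _ _ _ reg i a; [exact: leq_trans npos|exact: Pcol].
  case: a a1 => [|[|//]] _; first exact: P0.
  by apply: Prow (P0 i); rewrite -opprB; apply/in_rowspanN/esingle.
exact: Pcol.
Qed.

(** Setting the endpoint variables to 0, the rows of [M] generate all the row
    vectors. *)
Lemma interior_generated : bijective eo ->
  exists L : 'M[int]_(m, m + n), L *m lsubmx M = 1%:M.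
Proof.
move=> eob; apply: in_rowspan_rows => j.
have [_ evar _ _] := eP; have [v /(colour_generated eob)[z [y yE]] ev] := evar (lshift (n + n) j).
exists y; rewrite mulmx_lsub -yE ev delta_mx_lshift.
by rewrite opp_row_mx add_row_mx row_mxKl oppr0 addr0 rowE mulmx1.
Qed.

(** * Sweeping a braid from left to right *)

(** Modulo the rows of [M], the colours at level [t] are those that [f] assigns to
    the positions. *)
Definition coloured_by t (f : nat -> 'rV[int]_(m + (n + n))) :=
  forall i, in_rowspan M (colour i t - f (position B i t)).

Lemma coloured_const s t f : 0 <= s -> s <= t -> t <= 1 ->
  (forall u, s <= u -> u <= t -> uncrossed B u) -> coloured_by s f -> coloured_by t f.
Proof.
move=> s0 st t1 nc sf i; have := sf i.
rewrite /colour (@arc_index_const _ _ _ i s t) // => [|u su ut]; last exact: nc (ltW ut) i.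
rewrite (@position_const _ _ _ i s t) // => j u ji /andP[su ut].
apply: uncrossed_neq => //; [by rewrite eq_sym | | exact: nc].
by rewrite (le_trans s0 su) (le_trans ut t1).
Qed.

(** The only crossing between the levels [s] and [t] is at [u] and reads [l]. *)
Lemma coloured_letter s u t f l : 0 <= s -> s < u -> u < t -> t <= 1 ->
  (forall v, s <= v -> v <= t -> v != u -> uncrossed B v) ->
  (forall i j, under B i u -> under B j u -> i = j) ->
  letter_at B u l -> coloured_by s f -> coloured_by t (letter_act f l).
Proof.
case: l => g b s0 su ut t1 nc uniq [over [und [cr nearl nearr]]] sf.
have in01 v : s <= v -> v <= t -> 0 <= v <= 1.
  by move=> sv vt; rewrite (le_trans s0 sv) (le_trans vt t1).
have st : s < t := lt_trans su ut.
have Uu : under B und u by exists (over, u).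
have neq v i j : s <= v -> v <= t -> v != u -> j != i -> pos B i v != pos B j v.
  move=> sv vt vu ji; apply: uncrossed_neq => //; [by rewrite eq_sym|exact: in01|exact: nc].
have const i a c : s <= a -> a <= c -> c <= t -> (c < u) || (u < a) ->
    position B i a = position B i c.
  move=> sa ac ct nu; apply: position_const => //.
  - exact: le_trans s0 sa.
  - exact: le_trans ct t1.
  move=> j v ji /andP[av vc]; apply: neq => //.
  - exact: le_trans sa av.
  - exact: le_trans vc ct.
  case/orP: nu => h; first by rewrite lt_eqF // (le_lt_trans vc).
  by rewrite gt_eqF // (lt_le_trans h).
have [v1 [sv1 v1u [po pu]]] : exists v, [/\ s < v, v < u &
    position B over v = (if b then g.+1 else g) /\ position B und v = (if b then g else g.+1)].
  have /filter_ex[v [[? ?] ?]] : \forall v \near (u^'-)%classic, (s < v /\ v < u) /\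
    position B over v = (if b then g.+1 else g) /\ position B und v = (if b then g else g.+1).
    by apply: filterI nearl; apply: filterI; [exact: nbhs_left_gt|exact: nbhs_left_lt].
  by exists v.
have [v2 [uv2 v2t [po' pu']]] : exists v, [/\ u < v, v < t &
    position B over v = (if b then g else g.+1) /\ position B und v = (if b then g.+1 else g)].
  have /filter_ex[v [[? ?] ?]] : \forall v \near (u^'+)%classic, (u < v /\ v < t) /\
    position B over v = (if b then g else g.+1) /\ position B und v = (if b then g.+1 else g).
    by apply: filterI nearr; apply: filterI; [exact: nbhs_right_gt|exact: nbhs_right_lt].
  by exists v.
have v1t := lt_trans v1u ut; have sv2 := lt_trans su uv2.
have before i := const i s v1 (lexx s) (ltW sv1) (ltW v1t).
have after i := const i v2 t (ltW sv2) (ltW v2t) (lexx t).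
rewrite -before ?v1u // in po; rewrite -before ?v1u // in pu.
rewrite after ?uv2 ?orbT // in po'; rewrite after ?uv2 ?orbT // in pu'.
have colour_over i : i != und -> colour i t = colour i s.
  move=> iu; rewrite /colour -(@arc_index_const _ _ _ i s t) ?ltW // => v sv vt Uv.
  have [vu|vu] := eqVneq v u; last exact: (nc v sv (ltW vt) vu i).
  by rewrite vu in Uv; move: iu; rewrite (uniq _ _ Uv Uu) eqxx.
have gS : (g == g.+1) = false /\ (g.+1 == g) = false by split; lia.
move=> i; have [->|iund] := eqVneq i und.
  have H1 : in_rowspan M (colour und t - (colour over u *+ 2 - colour und s)).
    apply: (colour_under cr (ltW su) ut) => v sv vt vu.
    exact: nc sv (ltW vt) vu und.
  have H2 : colour over u = colour over s.
    rewrite /colour -(@arc_index_const _ _ _ over s u) ?ltW // => v sv vu.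
    by apply: (nc v sv (ltW (lt_trans vu ut)) _ over); rewrite lt_eqF.
  have := sf over; have := sf und; rewrite po pu pu' => H3 H4.
  have -> : letter_act f (g, b) (if b then g.+1 else g) =
      f (if b then g.+1 else g) *+ 2 - f (if b then g else g.+1).
    by case: (b); rewrite /= ?gS.1 ?gS.2 eqxx.
  rewrite H2 in H1; set a := colour und t in H1 *; set x := colour over s in H1 H4.
  set y := colour und s in H1 H3; set fo := f _ in H4 *; set fu := f _ in H3 *.
  have -> : a - (fo *+ 2 - fu) = (a - (x *+ 2 - y)) + (2 *: (x - fo) - (y - fu)).
    by apply/rowP => k; rewrite !mxE; ring.
  by apply: in_rowspanD => //; apply: in_rowspanB => //; apply: in_rowspanZ.
rewrite colour_over //; have [->|iover] := eqVneq i over.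
  have := sf over; rewrite po po'.
  by case: (b); rewrite /= eqxx.
have ncs : uncrossed B s by apply: (nc s (lexx s) (ltW st)); rewrite lt_eqF.
have s01 := in01 s (lexx s) (ltW st).
have same : position B i t = position B i s.
  apply/esym/(@position_const _ _ _ i s t s0 (ltW st) t1) => j v ji /andP[sv vt].
  have [vu|vu] := eqVneq v u; last exact: neq.
  rewrite vu; apply/eqP => pij.
  (* The only string passing under at this level is und, and it meets only
     over there. *)
  have u01 : 0 <= u <= 1 by apply: in01; apply: ltW.
  have ij : i != j by rewrite eq_sym.
  case: (crossing_or braid ij u01 pij) => c.
    have Ui : under B i u by exists (j, u).
    by move: iund; rewrite (uniq _ _ Ui Uu) eqxx.
  have Uj : under B j u by exists (i, u).
  rewrite (uniq _ _ Uj Uu) in c; have [e'] := crossing_uniq reg cr c.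
  by move: iover; rewrite e' eqxx.
have ni : position B i s != (if b then g.+1 else g).
  by rewrite -po; apply: contra iover => /eqP/(position_inj braid s01 ncs) ->.
have nj : position B i s != (if b then g else g.+1).
  by rewrite -pu; apply: contra iund => /eqP/(position_inj braid s01 ncs) ->.
have := sf i; rewrite same.
by rewrite /letter_act (negPf nj) (negPf ni).
Qed.

Lemma coloured_word (w : seq letter) (ts : seq R) s f :
  size ts = size w -> path <%R s ts -> 0 <= s -> s <= 1 ->
  (forall t, s <= t -> (t \in ts <-> exists i, under B i t)) ->
  (forall i j t, under B i t -> under B j t -> i = j) ->
  (forall k, (k < size w)%N -> letter_at B (nth 0 ts k) (nth (0%N, true) w k)) ->
  coloured_by s f -> coloured_by 1 (word_act f w).
Proof.
elim: w ts s f => [|l w IH] [|u ts] s f //=.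
  move=> _ _ s0 s1 tsP _ _; apply: coloured_const => // t st _ i Ut.
  by have /(tsP t st) : exists i, under B i t by exists i.
move=> [sz] /andP[su uts] s0 s1 tsP uniq letters sf.
have [i0 Ui0] : exists i, under B i u by apply/(tsP u (ltW su)); rewrite inE eqxx.
have /andP[u0 u1] := under_gt0_lt1 reg Ui0.
have ults : all (> u) ts by apply: order_path_min uts; apply: lt_trans.
(* The next sweep starts at a level t between u and the following crossing. *)
have [t [ut t1 tts]] : exists t, [/\ u < t, t <= 1 & all (> t) ts].
  case: ts tsP uts {sz letters ults} => [|u' ts] tsP /= => [_|/andP[uu' u'ts]].
    by exists 1.
  have uv : u < (u + u') / 2 < u' by lra.
  case/andP: uv => uv vu'; exists ((u + u') / 2); split=> //.
    have [i Ui] : exists i, under B i u'.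
      apply/(tsP u' (ltW (lt_trans su uu'))).
      by rewrite !inE eqxx orbT.
    apply: ltW (lt_trans vu' _).
    by have /andP[] := under_gt0_lt1 reg Ui.
  rewrite vu' /=; apply/allP => x /(allP (order_path_min (@lt_trans _ R) u'ts)).
  exact: lt_trans.
have st := lt_trans su ut.
apply: (IH ts t (letter_act f l)) => //.
- by rewrite path_sortedE ?tts ?(path_sorted uts) //; apply: lt_trans.
- exact: le_trans s0 (ltW st).
- move=> v tv; rewrite -(tsP v (le_trans (ltW st) tv)) inE gt_eqF //.
  exact: lt_le_trans ut tv.
- by move=> k kw; apply: (letters k.+1).
apply: (coloured_letter s0 su ut t1 _ _ (letters 0%N (ltn0Sn _)) sf).
  move=> v sv vt vu i Uv; have : v \in u :: ts by apply/tsP => //; exists i.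
  by rewrite inE (negPf vu) /= => /(allP tts); rewrite ltNge vt.
by move=> i j; apply: uniq.
Qed.

End ArcVectors.
End Coloring.

Lemma left_right_order_bij (R : realType) n (B : tangle R n) eo :
  left_right_order B eo -> bijective eo.
Proof.
move=> ord; apply: inj_card_bij; last by rewrite card_prod card_bool !card_ord addnn muln2.
have inj_pos (i j : 'I_n) : i.+1 = j.+1 -> i = j by case=> /val_inj.
move=> x y; case: (split_ordP x) => i ->; case: (split_ordP y) => j -> e;
  have [s1 p1 s2 p2] := ord i; have [s3 p3 s4 p4] := ord j.
- by congr lshift; apply: inj_pos; rewrite -p1 -p3 e.
- by move: s4; rewrite -e s1.
- by move: s2; rewrite e s3.
- by congr rshift; apply: inj_pos; rewrite -p2 -p4 e.
Qed.

(** The left half is unitriangular. *)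
Lemma three_braid_matrix_unit c : lsubmx (three_braid_matrix c) \in unitmx.
Proof.
have tri : is_trig_mx (lsubmx (three_braid_matrix c))^T.
  apply/is_trig_mxP => i j ij; rewrite !mxE.
  by case: i j ij => [[|[|[|//]]] ?] [[|[|[|//]]] ?].
rewrite unitmxE -det_tr (det_trig tri).
by apply: unitr_prod => i _; rewrite !mxE; case: i => [[|[|[|//]]] ?].
Qed.

(** The rows of the target, placed in the endpoint columns, are combinations of
    the rows of the coloring matrix. *)
Lemma three_braid_matrix_generated (R : realType) (c : seq int) (B : tangle R 3)
    (eo : 'I_(3 + 3) -> endpoint 3) m (M : 'M[int]_(m + 3, m + (3 + 3))) e :
  odd (size c) -> is_braid B -> regular B -> reads_word B (three_braid_word c) ->
  left_right_order B eo -> arc_vectors B eo M e ->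
  exists K : 'M[int]_(3, m + 3), K *m M = row_mx 0 (three_braid_matrix c).
Proof.
move=> oc braid reg [ts [[sts szts] tsP uniq letters]] ord eP.
have [eend _ _ esingle] := eP.
(* Positions start from 1. *)
pose f p := e (endpoint_var B (eo (lshift 3 (inord p.-1)))).
have ts01 t : t \in ts -> 0 < t < 1.
  by move=> /tsP[i]; apply: under_gt0_lt1.
have unc0 : uncrossed B 0 by move=> i /(under_gt0_lt1 reg); rewrite ltxx.
have f0 : coloured_by B M e 0 f.
  move=> i; have := position_leq B i 0; set p := position B i 0 => p3.
  rewrite /f; set x : 'I_3 := inord _.
  have px : p = x.+1 by rewrite inordK.
  have [x1 x2 _ _] := ord x.
  have ix : i = (eo (lshift 3 x)).1.
    by apply: (position_inj braid _ unc0); rewrite ?lexx ?ler01 // x2.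
  rewrite /colour /endpoint_var x1 -ix arc_index_eq0 ?subrr; first exact: in_rowspan0.
  by move=> u /(under_gt0_lt1 reg)/andP[/ltW].
have f1 : coloured_by B M e 1 (word_act f (three_braid_word c)).
  apply: (coloured_word reg eP braid szts _ (lexx 0) ler01 _ uniq letters f0).
    rewrite path_sortedE; last exact: lt_trans.
    by rewrite sts andbT; apply/allP => t /ts01/andP[].
  by move=> t _; apply: tsP.
apply: in_rowspan_rows => r.
set f' := word_act _ _ in f1.
pose T := three_braid_matrix c.
have fx (j : 'I_3) : f j.+1 = delta_mx 0 (rshift m (lshift 3 j)).
  by rewrite /f /= inord_val eend.
have fy (j : 'I_3) : in_rowspan M (delta_mx 0 (rshift m (rshift 3 j)) - f' j.+1).
  have [_ _ y1 y2] := ord j; rewrite -eend /endpoint_var y1.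
  set i := (eo _).1 in y2 *; have := f1 i; rewrite y2 /colour.
  rewrite (arc_index_nunder reg) // /last_arc.
  have [n0|npos] := posnP (nunder B i); last by rewrite (maxn_idPr npos).
  rewrite n0 => H; have := in_rowspanB H (esingle i n0).
  by rewrite opprB addrC addrA subrK.
have -> : row r (row_mx 0 T) =
    \sum_(j < 3) T r (rshift 3 j) *: (delta_mx 0 (rshift m (rshift 3 j)) - f' j.+1).
  have rel : \sum_(j < 3) T r (lshift 3 j) *: f j.+1 +
             \sum_(j < 3) T r (rshift 3 j) *: f' j.+1 = 0.
    apply/rowP => k; rewrite !mxE !summxE.
    rewrite -[RHS](three_braid_matrix_relations (fun p => f p 0 k) r oc).
    congr (_ + _); apply: eq_bigr => j _; rewrite mxE // /f'.
    congr (_ * _); apply: (word_act_morph (h := fun v : 'rV_(m + (3 + 3)) => v 0 k)).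
      by move=> v w; rewrite mxE.
    by move=> v w; rewrite !mxE.
  have -> : row r (row_mx 0 T) = \sum_(j < 3) T r (lshift 3 j) *: f j.+1 +
      \sum_(j < 3) T r (rshift 3 j) *: delta_mx 0 (rshift m (rshift 3 j)).
    rewrite [LHS]row_sum_delta big_split_ord /= big1 ?add0r => [|j _]; last first.
      by rewrite mxE row_mxEl mxE scale0r.
    rewrite big_split_ord; congr (_ + _); apply: eq_bigr => j _.
      by rewrite fx mxE row_mxEr.
    by rewrite mxE row_mxEr.
  rewrite -[LHS]subr0 -[X in _ - X]rel opprD addrACA subrr add0r -sumrB.
  by apply: eq_bigr => j _; rewrite scalerBr.
by apply: in_rowspan_sum => j; apply: in_rowspanZ.
Qed.

Theorem mainTheorem2 (R : realType) :
  (forall (n : nat) (B : tangle R n), is_braid B -> regular B ->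
     forall eo : 'I_(n + n) -> endpoint n, bijective eo ->
     forall (m : nat) (M : 'M[int]_(m + n, m + (n + n))),
       is_coloring_matrix B eo M -> dU M = 1)
  /\
  (forall (c : seq int) (B : tangle R 3), odd (size c) ->
     is_braid B -> regular B -> reads_word B (three_braid_word c) ->
     forall eo : 'I_(3 + 3) -> endpoint 3, left_right_order B eo ->
     forall (m : nat) (M : 'M[int]_(m + 3, m + (3 + 3))),
       is_coloring_matrix B eo M -> row_equiv (Ml M) (three_braid_matrix c)).
Proof.
split=> [n B braid reg eo eob m M /(coloring_arc_vectors reg)[e eP]|].
  by have [L /dU_eq1] := interior_generated reg eP braid eob.
move=> c B oc braid reg word eo ord m M /(coloring_arc_vectors reg)[e eP].
have [L LM] := interior_generated reg eP braid (left_right_order_bij ord).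
have [K KM] := three_braid_matrix_generated oc braid reg word ord eP.
exact: (Ml_row_equiv LM KM (three_braid_matrix_unit c)).
Qed.
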